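(* Let $f\colon\partial\mathbb{D}\to\mathbb{C}$ be a bounded and piecewise continuous function with only a finite number of discontinuities, at one of which the one-sided limits exist and are unequal. Then for any irrational number $q$ and every $\theta\in\mathbb{R}$, the power series $$\sum_{n=0}^\infty f\bigl(e^{2\pi i(qn+\theta)}\bigr)z^n$$ has a strong natural boundary on $\partial\mathbb{D}$.
   Context: $\mathbb{D}=\{z\in\mathbb{C}: |z|<1\}$, $\partial\mathbb{D}$ is the unit circle, and an open interval $I\subset\partial\mathbb{D}$ means a nonempty open arc. The number $q$ is real. Strong natural boundary: a function $g$, analytic on $\mathbb{D}$, has a strong natural boundary on $\partial\mathbb{D}$ if for every open interval $I\subset\partial\mathbb{D}$ one has $\sup_{0<r<1}\int_{e^{i\theta}\in I}|g(re^{i\theta})|\,\frac{d\theta}{2\pi}=\infty$. *)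

(* Defs.v *)
From Stdlib Require Import Reals QArith Qreals List.
From Coquelicot Require Import Coquelicot.
Open Scope R_scope.

Definition expi (t : R) : C := (cos t, sin t).

Definition unit_disk (z : C) : Prop := Cmod z < 1.

Definition unit_circle (z : C) : Prop := Cmod z = 1.

(* A function on the unit circle is represented by a total function [C -> C] of
   which only the values on the circle matter. *)
Definition bounded_on_circle (f : C -> C) : Prop :=
  exists M : R, forall z : C, unit_circle z -> Cmod (f z) <= M.

(* Continuity at [z] for the subspace topology of the circle. *)
Definition circle_continuous_at (f : C -> C) (z : C) : Prop :=
  filterlim f (within unit_circle (locally z)) (locally (f z)).

Definition circle_discontinuity (f : C -> C) (z : C) : Prop :=
  unit_circle z /\ ~ circle_continuous_at f z.

(* Piecewise continuous with finitely many discontinuities; nothing is required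
   about one-sided limits at the discontinuities. *)
Definition finitely_many_discontinuities (f : C -> C) : Prop :=
  exists l : list C, forall z : C, circle_discontinuity f z -> In z l.

Definition unequal_one_sided_limits (f : C -> C) (z : C) : Prop :=
  exists (t : R) (l1 l2 : C),
    z = expi t /\
    filterlim (fun s => f (expi s)) (at_left t) (locally l1) /\
    filterlim (fun s => f (expi s)) (at_right t) (locally l2) /\
    l1 <> l2.

Definition irrational (q : R) : Prop := forall p : Q, Q2R p <> q.

Definition analytic_on_disk (g : C -> C) : Prop :=
  forall z : C, unit_disk z -> @ex_derive C_AbsRing C_NormedModule g z.

(* The open arc is { expi t | a < t < b } with 0 < b - a <= 2 PI, so that each of
   its points is counted once in the integral over [a, b].  For [g] analytic on
   the disk the integrand is continuous, so [RInt] is its actual integral. *)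
Definition arc_mean (g : C -> C) (a b r : R) : R :=
  RInt (fun t : R => Cmod (g (RtoC r * expi t)%C) / (2 * PI)) a b.

Definition strong_natural_boundary (g : C -> C) : Prop :=
  analytic_on_disk g /\
  forall a b : R, a < b <= a + 2 * PI ->
    Lub_Rbar (fun x : R => exists r : R, 0 < r < 1 /\ x = arc_mean g a b r)
      = p_infty.

(* The sum [g] is determined on the disk, and [strong_natural_boundary g] depends
   only on the values of [g] there. *)
Definition pseries_strong_natural_boundary (c : nat -> C) : Prop :=
  exists g : C -> C,
    (forall z : C, unit_disk z -> @is_pseries C_AbsRing C_NormedModule c z (g z)) /\
    strong_natural_boundary g.

(* Main.v *)
Require Import Defs.
From Stdlib Require Import Reals QArith Qreals List.
From Stdlib Require Import ZArith Psatz Classical IndefiniteDescription.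
From Coquelicot Require Import Coquelicot.
Open Scope R_scope.
Set Bullet Behavior "Strict Subproofs".

(** Write [F x = f (expi x)], [tau = 2 PI q], [x_n = 2 PI theta + n tau], so that the
    coefficients of the series are [a_n = F x_n], a function observed along an
    irrational rotation.  The proof looks for an integer [j] such that the frequency
    [tau j] lies, modulo [2 PI], in a prescribed arc and such that the Cesaro means of
    [F x_n * expi (j x_n)] tend to some [c <> 0].

    Such a [j] gives the divergence.  With [zeta = expi (tau j)], the means of
    [a_n * zeta^n] tend to [c] up to a factor of modulus 1, and summation by parts shows
    that [g (zeta w)] looks like [c / (1 - w)] in every Stolz angle at [w = 1]
    ([mean_gives_pole]).  The modulus of [c / (1 - w)] has integral at least
    [|c| ln (1 + X)] over a piece of the circle of radius [r] of length [X (1 - r)], and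
    [X] is arbitrary ([pole_integral_diverges]).  The means in question always exist,
    because [F] is bounded and continuous off finitely many points of the circle, which
    the rotation visits rarely ([orbit_mean_exists]).

    It remains to exclude that all means [c_j] with [tau j] in the arc vanish
    ([jump_gives_resonance]).  Assume that they do.  Choose an absolutely summable family
    [u l], [l] in [Z], whose Fourier series [sum u l * expi (l y)] vanishes for [y] outside
    the arc ([gap_weights_exist]), and put [H x = sum u l * F (x - tau (l - 1))].  The mean
    of [H] against the character [expi (j x)] is [c_j] times the value of the Fourier
    series of [u] at [tau j], up to a factor of modulus 1, so it vanishes for every [j].
    Testing against Fejer kernels, [H] can then have no nonzero one-sided limit
    ([local_value_small_of_zero_means], [one_sided_limit_zero]).  On the other hand let
    [t] be the jump of [F].  The term [l = 1] of [H x] is [u 1 * F x].  By irrationality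
    only finitely many [l <> 1] move [t] to a discontinuity of [F], and [u] can be chosen
    to vanish at all of these while [u 1 <> 0].  Hence [H] has at [t] the nonzero jump
    [u 1 * (l2 - l1)], a contradiction.

    The weights [u] are explicit.  The series [sum cos (l y) / l^2] is a quadratic
    polynomial on [(0, 2 PI)], so its third difference with a small step [h] vanishes
    there except near [0].  Further operators [Phi (y - h) - expi (- s h) * Phi y] keep the
    gap, up to [h], and kill the coefficient of index [s]. *)

(** * Points of the circle by their angle *)

Lemma expi_add (x y : R) : expi (x + y) = (expi x * expi y)%C.
Proof.
  unfold expi, Cmult; simpl; rewrite cos_plus, sin_plus; f_equal; ring.
Qed.

Lemma expi_0 : expi 0 = 1.
Proof. unfold expi; rewrite cos_0, sin_0; reflexivity. Qed.

Lemma Cmod_expi (x : R) : Cmod (expi x) = 1.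
Proof.
  unfold Cmod, expi; simpl.
  replace (cos x * (cos x * 1) + sin x * (sin x * 1)) with 1.
  - apply sqrt_1.
  - pose proof (sin2_cos2 x) as H; unfold Rsqr in H; lra.
Qed.

Lemma expi_neq_0 (x : R) : expi x <> 0.
Proof. intros H. pose proof (Cmod_expi x) as K. rewrite H, Cmod_0 in K. lra. Qed.

Lemma sin_IZR_PI (k : Z) : sin (IZR k * PI) = 0.
Proof. apply sin_eq_0_1. exists k; reflexivity. Qed.

Lemma expi_2kPI (k : Z) : expi (2 * PI * IZR k) = 1.
Proof.
  unfold expi. replace (2 * PI * IZR k) with (2 * (IZR k * PI)) by ring.
  rewrite cos_2a_sin, sin_2a, sin_IZR_PI. unfold RtoC; f_equal; ring.
Qed.

Lemma expi_period (x : R) (k : Z) : expi (x + 2 * PI * IZR k) = expi x.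
Proof. rewrite expi_add, expi_2kPI; ring. Qed.

Lemma expi_eq_1 (x : R) : expi x = 1 -> exists k : Z, x = 2 * PI * IZR k.
Proof.
  intros H. injection H as Hc Hs.
  destruct (sin_eq_0_0 (x / 2)) as [k Hk].
  - replace x with (2 * (x / 2)) in Hc by field.
    rewrite cos_2a_sin in Hc. nra.
  - exists k. lra.
Qed.

Lemma expi_eq (x y : R) : expi x = expi y -> exists k : Z, x = y + 2 * PI * IZR k.
Proof.
  intros H. destruct (expi_eq_1 (x - y)) as [k Hk].
  - unfold Rminus. rewrite expi_add, H, <- expi_add, Rplus_opp_r. apply expi_0.
  - exists k; lra.
Qed.

Lemma expi_cos (t : R) : RtoC (2 * cos t) = (expi t + expi (- t))%C.
Proof. unfold expi. rewrite cos_neg, sin_neg. apply injective_projections; simpl; ring. Qed.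

Lemma Rabs_sin_le (x : R) : Rabs (sin x) <= Rabs x.
Proof.
  assert (P : forall t, 0 <= t -> Rabs (sin t) <= t).
  { intros t Ht. pose proof (SIN_bound t) as B.
    destruct (Rle_lt_dec 1 t).
    - apply Rabs_le; lra.
    - destruct (Req_dec t 0) as [-> | Hn].
      + rewrite sin_0, Rabs_R0; lra.
      + pose proof (sin_lt_x t ltac:(lra)).
        pose proof (sin_ge_0 t Ht ltac:(pose proof PI_RGT_0; pose proof PI2_1; lra)).
        rewrite Rabs_pos_eq; lra. }
  destruct (Rle_lt_dec 0 x).
  - rewrite (Rabs_pos_eq x) by assumption. apply P; assumption.
  - rewrite (Rabs_left x), <- (Rabs_Ropp (sin x)), <- sin_neg by lra. apply P; lra.
Qed.

Lemma Cmod_sqr (z : C) : Cmod z ^ 2 = fst z ^ 2 + snd z ^ 2.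
Proof.
  unfold Cmod. rewrite pow2_sqrt; [reflexivity |].
  pose proof (pow2_ge_0 (fst z)); pose proof (pow2_ge_0 (snd z)); lra.
Qed.

Lemma Cmod_expi_minus_sqr (x y : R) :
  Cmod (expi x - expi y) ^ 2 = 2 - 2 * cos (x - y).
Proof.
  rewrite Cmod_sqr; unfold expi; simpl. rewrite cos_minus.
  pose proof (sin2_cos2 x) as H; pose proof (sin2_cos2 y) as K; unfold Rsqr in *. nra.
Qed.

Lemma two_minus_two_cos_le (u : R) : 2 - 2 * cos u <= u ^ 2.
Proof.
  replace u with (2 * (u / 2)) at 1 by field. rewrite cos_2a_sin.
  pose proof (Rabs_sin_le (u / 2)) as H.
  apply Rsqr_le_abs_1 in H. unfold Rsqr in H. nra.
Qed.

Lemma Cmod_expi_minus_le (x y : R) : Cmod (expi x - expi y) <= Rabs (x - y).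
Proof.
  apply Rsqr_incr_0_var; [| apply Rabs_pos].
  rewrite <- Rsqr_abs. unfold Rsqr at 1.
  pose proof (Cmod_expi_minus_sqr x y) as H. pose proof (two_minus_two_cos_le (x - y)) as K.
  unfold Rsqr. simpl in H, K. lra.
Qed.

Lemma reduce_mod_2PI (x : R) : exists k : Z, 0 <= x + 2 * PI * IZR k < 2 * PI.
Proof.
  pose proof PI_RGT_0 as P.
  destruct (base_Int_part (x / (2 * PI))) as [H1 H2].
  exists (- Int_part (x / (2 * PI)))%Z. rewrite opp_IZR.
  set (k := IZR (Int_part _)) in *.
  assert (E : x = 2 * PI * (x / (2 * PI))) by (field; lra).
  assert (T : x + 2 * PI * - k = 2 * PI * (x / (2 * PI) - k)) by (rewrite E at 1; ring).
  rewrite T. split; nra.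
Qed.

Lemma cos_bounded_off_1 (a b : R) : 0 < a -> a <= b -> b < 2 * PI ->
  exists eta, 0 < eta /\ forall t, a <= t <= b -> cos t <= 1 - eta.
Proof.
  intros Ha Hab Hb.
  destruct (continuity_ab_maj cos a b Hab) as (m & Hm & Hmab).
  { intros c _. apply continuity_cos. }
  exists (1 - cos m). split; [| intros t Ht; specialize (Hm t Ht); lra].
  pose proof (COS_bound m) as Bm. destruct (Req_dec (cos m) 1) as [E | E]; [exfalso | lra].
  destruct (expi_eq_1 m) as [k Hk].
  - unfold expi. rewrite E. pose proof (sin2_cos2 m) as S1. unfold Rsqr in S1.
    replace (sin m) with 0 by nra. reflexivity.
  - pose proof PI_RGT_0.
    assert (0 < IZR k < 1) by nra.
    destruct H0 as [H1 H2]. apply lt_IZR in H1. apply lt_IZR in H2. lia.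
Qed.

(** Converts closeness of cosines, the form in which Fejer kernels see distance, into
    closeness of angles modulo [2 PI]. *)
Lemma cos_near_1 (rho : R) : 0 < rho <= PI ->
  exists eta, 0 < eta /\ forall x, 1 - eta < cos x ->
    exists k : Z, Rabs (x + 2 * PI * IZR k) < rho.
Proof.
  intros Hr. pose proof PI_RGT_0.
  destruct (cos_bounded_off_1 rho (2 * PI - rho)) as (eta & He & Hc); try lra.
  exists eta. split; [assumption |]. intros x Hx.
  destruct (reduce_mod_2PI x) as [k Hk].
  assert (E : cos (x + 2 * PI * IZR k) = cos x)
    by (pose proof (expi_period x k) as P; injection P as P _; exact P).
  destruct (Rlt_le_dec (x + 2 * PI * IZR k) rho) as [L | L].
  - exists k. apply Rabs_def1; lra.
  - destruct (Rlt_le_dec (2 * PI - rho) (x + 2 * PI * IZR k)) as [L' | L'].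
    + exists (k - 1)%Z. rewrite minus_IZR. apply Rabs_def1; lra.
    + specialize (Hc _ (conj L L')). lra.
Qed.

Definition irrational_rotation (tau : R) : Prop :=
  forall k : Z, expi (tau * IZR k) = 1 -> k = 0%Z.

Lemma irrational_rotation_2PI (q : R) :
  irrational q -> irrational_rotation (2 * PI * q).
Proof.
  intros hq k H. apply expi_eq_1 in H as [m Hm].
  destruct (Z.eq_dec k 0) as [-> | Hk]; [reflexivity | exfalso].
  assert (E : q * IZR k = IZR m).
  { pose proof PI_RGT_0. apply (Rmult_eq_reg_l (2 * PI)); lra. }
  assert (Hk' : IZR k <> 0) by (apply not_0_IZR; assumption).
  apply (hq (Qmult (inject_Z m) (Qinv (inject_Z k)))).
  rewrite Q2R_mult, Q2R_inv.
  - unfold Q2R; simpl. rewrite <- E. field. assumption.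
  - intros F. apply Hk. unfold Qeq in F; simpl in F. lia.
Qed.

Definition periodic_2PI (F : R -> C) : Prop :=
  forall x (k : Z), F (x + 2 * PI * IZR k) = F x.

(** * Finite sums and limits of complex sequences *)

Fixpoint Csum (u : nat -> C) (N : nat) : C :=
  match N with O => 0%R | S n => (Csum u n + u n)%C end.

Fixpoint Rsum (u : nat -> R) (N : nat) : R :=
  match N with O => 0 | S n => Rsum u n + u n end.

Lemma Csum_ext (u v : nat -> C) (N : nat) :
  (forall n, (n < N)%nat -> u n = v n) -> Csum u N = Csum v N.
Proof.
  induction N as [| N IH]; intros H; simpl; [reflexivity |].
  rewrite IH, H; auto with arith.
Qed.

Lemma Csum_plus (u v : nat -> C) (N : nat) :
  Csum (fun n => u n + v n)%C N = (Csum u N + Csum v N)%C.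
Proof. induction N as [| N IH]; simpl; [| rewrite IH]; ring. Qed.

Lemma Csum_scal (a : C) (u : nat -> C) (N : nat) :
  Csum (fun n => a * u n)%C N = (a * Csum u N)%C.
Proof. induction N as [| N IH]; simpl; [| rewrite IH]; ring. Qed.

Lemma Csum_add (u : nat -> C) (N M : nat) :
  Csum u (N + M) = (Csum u N + Csum (fun n => u (N + n)%nat) M)%C.
Proof.
  induction M as [| M IH]; simpl.
  - rewrite Nat.add_0_r; ring.
  - rewrite Nat.add_succ_r; simpl; rewrite IH; ring.
Qed.

Lemma Csum_Cmod_le (u : nat -> C) (v : nat -> R) (N : nat) :
  (forall n, (n < N)%nat -> Cmod (u n) <= v n) -> Cmod (Csum u N) <= Rsum v N.
Proof.
  induction N as [| N IH]; intros H; simpl.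
  - rewrite Cmod_0; lra.
  - eapply Rle_trans; [apply Cmod_triangle |].
    apply Rplus_le_compat; auto with arith.
Qed.

Lemma Rsum_le (u v : nat -> R) (N : nat) :
  (forall n, (n < N)%nat -> u n <= v n) -> Rsum u N <= Rsum v N.
Proof.
  induction N as [| N IH]; intros H; simpl; [lra |].
  apply Rplus_le_compat; auto with arith.
Qed.

Lemma Rsum_const (c : R) (N : nat) : Rsum (fun _ => c) N = INR N * c.
Proof. induction N as [| N IH]; [simpl; ring |]. rewrite S_INR; simpl; rewrite IH; ring. Qed.

Lemma Rsum_plus (u v : nat -> R) (N : nat) :
  Rsum (fun n => u n + v n) N = Rsum u N + Rsum v N.
Proof. induction N as [| N IH]; simpl; [| rewrite IH]; ring. Qed.

Lemma Rsum_scal (a : R) (u : nat -> R) (N : nat) :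
  Rsum (fun n => a * u n) N = a * Rsum u N.
Proof. induction N as [| N IH]; simpl; [| rewrite IH]; ring. Qed.

Lemma Rsum_add (u : nat -> R) (N M : nat) :
  Rsum u (N + M) = Rsum u N + Rsum (fun n => u (N + n)%nat) M.
Proof.
  induction M as [| M IH]; simpl.
  - rewrite Nat.add_0_r; ring.
  - rewrite Nat.add_succ_r; simpl; rewrite IH; ring.
Qed.

Lemma Csum_RtoC (u : nat -> R) (N : nat) :
  Csum (fun n => RtoC (u n)) N = RtoC (Rsum u N).
Proof. induction N as [| N IH]; simpl; [reflexivity |]. rewrite IH, RtoC_plus; reflexivity. Qed.

Lemma Cmod_minus_sym (a b : C) : Cmod (a - b) = Cmod (b - a).
Proof. rewrite <- Cmod_opp. f_equal; ring. Qed.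

Lemma Cmod_triangle_sub (a b c : C) : Cmod (a - c) <= Cmod (a - b) + Cmod (b - c).
Proof. replace (a - c)%C with ((a - b) + (b - c))%C by ring. apply Cmod_triangle. Qed.

Lemma Cmod_le_of_close (a b : C) : Cmod a <= Cmod b + Cmod (a - b).
Proof. replace a with (b + (a - b))%C at 1 by ring. apply Cmod_triangle. Qed.

Lemma Cmod_eq_0_of_small (z : C) : (forall eps, 0 < eps -> Cmod z <= eps) -> z = 0.
Proof.
  intros H. apply Cmod_eq_0. apply Rle_antisym; [| apply Cmod_ge_0].
  apply le_epsilon; intros e He. rewrite Rplus_0_l; auto.
Qed.

Lemma INR_eventually_ge (K eps : R) : 0 < eps ->
  exists N0, forall N, (N0 <= N)%nat -> K <= eps * INR N.
Proof.
  intros He. destruct (INR_unbounded (K / eps)) as [N0 HN]. exists N0. intros N HN'.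
  apply le_INR in HN'. apply Rle_trans with (eps * (K / eps)).
  - right; field; lra.
  - apply Rmult_le_compat_l; lra.
Qed.

Lemma inv_INR_small (K eps : R) : 0 <= K -> 0 < eps ->
  exists N0, forall N, (N0 <= N)%nat -> K / (INR N + 1) <= eps.
Proof.
  intros HK He. destruct (INR_eventually_ge K eps He) as [N0 HN]. exists N0. intros N H.
  specialize (HN N H). pose proof (pos_INR N).
  apply Rmult_le_reg_r with (INR N + 1); [lra |].
  replace (K / (INR N + 1) * (INR N + 1)) with K by (field; lra). nra.
Qed.

Definition Ctends (u : nat -> C) (l : C) : Prop :=
  forall eps, 0 < eps -> exists N, forall n, (N <= n)%nat -> Cmod (u n - l) <= eps.

Lemma Ctends_unique (u : nat -> C) (l m : C) : Ctends u l -> Ctends u m -> l = m.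
Proof.
  intros Hl Hm. apply Ceq_minus, Cmod_eq_0_of_small. intros e He.
  destruct (Hl (e / 2)) as [N HN]; [lra |]. destruct (Hm (e / 2)) as [M HM]; [lra |].
  specialize (HN (N + M)%nat ltac:(lia)). specialize (HM (N + M)%nat ltac:(lia)).
  pose proof (Cmod_triangle_sub l (u (N + M)%nat) m) as T.
  rewrite (Cmod_minus_sym l (u _)) in T. lra.
Qed.

Lemma Ctends_plus (u v : nat -> C) (l m : C) :
  Ctends u l -> Ctends v m -> Ctends (fun n => u n + v n)%C (l + m)%C.
Proof.
  intros Hl Hm e He.
  destruct (Hl (e / 2)) as [N HN]; [lra |]. destruct (Hm (e / 2)) as [M HM]; [lra |].
  exists (N + M)%nat. intros n Hn.
  specialize (HN n ltac:(lia)). specialize (HM n ltac:(lia)).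
  replace (u n + v n - (l + m))%C with ((u n - l) + (v n - m))%C by ring.
  eapply Rle_trans; [apply Cmod_triangle | lra].
Qed.

Lemma Ctends_const (c : C) : Ctends (fun _ => c) c.
Proof. intros e He. exists O. intros n _. unfold Cminus. rewrite Cplus_opp_r, Cmod_0. lra. Qed.

Lemma Ctends_scal (a : C) (u : nat -> C) (l : C) :
  Ctends u l -> Ctends (fun n => a * u n)%C (a * l)%C.
Proof.
  intros Hl e He. pose proof (Cmod_ge_0 a).
  destruct (Hl (e / (Cmod a + 1))) as [N HN]; [apply Rdiv_lt_0_compat; lra |].
  exists N. intros n Hn. specialize (HN n Hn).
  replace (a * u n - a * l)%C with (a * (u n - l))%C by ring.
  rewrite Cmod_mult.
  apply Rle_trans with ((Cmod a + 1) * (e / (Cmod a + 1))).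
  - apply Rmult_le_compat; try lra; apply Cmod_ge_0.
  - right; field; lra.
Qed.

Lemma Ctends_ext (u v : nat -> C) (l : C) :
  (forall n, u n = v n) -> Ctends u l -> Ctends v l.
Proof.
  intros E H e He. destruct (H e He) as [N HN]. exists N. intros n Hn. rewrite <- E; auto.
Qed.

Lemma Ctends_bound (u : nat -> C) (l : C) (B : R) (N0 : nat) :
  Ctends u l -> (forall n, (N0 <= n)%nat -> Cmod (u n) <= B) -> Cmod l <= B.
Proof.
  intros H Hb. apply le_epsilon; intros e He. destruct (H e He) as [N HN].
  specialize (HN (N + N0)%nat ltac:(lia)). specialize (Hb (N + N0)%nat ltac:(lia)).
  pose proof (Cmod_le_of_close l (u (N + N0)%nat)) as T.
  rewrite Cmod_minus_sym in T. lra.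
Qed.

Lemma Ctends_shift (u : nat -> C) (l : C) :
  Ctends u l -> Ctends (fun n => u (S n)) l.
Proof.
  intros H e He. destruct (H e He) as [N HN]. exists N. intros n Hn. apply HN; lia.
Qed.

Lemma Ctends_cauchy (u : nat -> C) :
  (forall eps, 0 < eps -> exists N, forall n m, (N <= n)%nat -> (N <= m)%nat ->
     Cmod (u n - u m) <= eps) -> exists l, Ctends u l.
Proof.
  intros H.
  assert (A : ex_finite_lim_seq (fun n => fst (u n))).
  { apply ex_lim_seq_cauchy_corr. intros e.
    destruct (H (e / 2)) as [N HN]; [apply is_pos_div_2 |].
    exists N. intros n m Hn Hm. specialize (HN n m Hn Hm).
    pose proof (re_le_Cmod (u n - u m)%C) as K. unfold Re in K. simpl in K.
    pose proof (cond_pos e). unfold Rminus. lra. }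
  assert (B : ex_finite_lim_seq (fun n => snd (u n))).
  { apply ex_lim_seq_cauchy_corr. intros e.
    destruct (H (e / 2)) as [N HN]; [apply is_pos_div_2 |].
    exists N. intros n m Hn Hm. specialize (HN n m Hn Hm).
    pose proof (Rmax_Cmod (u n - u m)%C) as K. simpl in K.
    pose proof (Rmax_r (Rabs (fst (u n) + - fst (u m))) (Rabs (snd (u n) + - snd (u m)))).
    pose proof (cond_pos e). unfold Rminus. lra. }
  destruct A as [a Ha]. destruct B as [b Hb]. exists (a, b). intros e He.
  apply is_lim_seq_spec in Ha. apply is_lim_seq_spec in Hb.
  assert (He2 : 0 < e / 2) by lra.
  destruct (Ha (mkposreal _ He2)) as [N HN]. destruct (Hb (mkposreal _ He2)) as [M HM].
  exists (N + M)%nat. intros n Hn.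
  specialize (HN n ltac:(lia)). specialize (HM n ltac:(lia)). simpl in HN, HM.
  replace (u n - (a, b))%C with (RtoC (fst (u n) - a) + RtoC (snd (u n) - b) * Ci)%C.
  - eapply Rle_trans; [apply Cmod_triangle |].
    rewrite Cmod_mult, !Cmod_R, Cmod_Ci. lra.
  - apply injective_projections; simpl; ring.
Qed.

(** * Cesaro means *)

(** Cesaro convergence, multiplied by [N] to avoid a division by zero. *)
Definition has_mean (u : nat -> C) (c : C) : Prop :=
  forall eps, 0 < eps -> exists N0, forall N, (N0 <= N)%nat ->
    Cmod (Csum u N - INR N * c) <= eps * INR N.

Lemma has_mean_ext (u v : nat -> C) (c : C) :
  (forall n, u n = v n) -> has_mean u c -> has_mean v c.
Proof.
  intros E H e He. destruct (H e He) as [N0 HN]. exists N0. intros N HN'.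
  rewrite (Csum_ext v u); auto.
Qed.

Lemma has_mean_plus (u v : nat -> C) (c d : C) :
  has_mean u c -> has_mean v d -> has_mean (fun n => u n + v n)%C (c + d)%C.
Proof.
  intros Hu Hv e He.
  destruct (Hu (e / 2)) as [N HN]; [lra |]. destruct (Hv (e / 2)) as [M HM]; [lra |].
  exists (N + M)%nat. intros n Hn.
  specialize (HN n ltac:(lia)). specialize (HM n ltac:(lia)).
  rewrite Csum_plus.
  replace (Csum u n + Csum v n - INR n * (c + d))%C
    with ((Csum u n - INR n * c) + (Csum v n - INR n * d))%C by ring.
  eapply Rle_trans; [apply Cmod_triangle | lra].
Qed.

Lemma has_mean_scal (a : C) (u : nat -> C) (c : C) :
  has_mean u c -> has_mean (fun n => a * u n)%C (a * c)%C.
Proof.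
  intros Hu e He. pose proof (Cmod_ge_0 a).
  destruct (Hu (e / (Cmod a + 1))) as [N HN]; [apply Rdiv_lt_0_compat; lra |].
  exists N. intros n Hn. specialize (HN n Hn).
  rewrite Csum_scal.
  replace (a * Csum u n - INR n * (a * c))%C with (a * (Csum u n - INR n * c))%C by ring.
  rewrite Cmod_mult.
  apply Rle_trans with ((Cmod a + 1) * (e / (Cmod a + 1) * INR n)).
  - apply Rmult_le_compat; try lra; apply Cmod_ge_0.
  - right; field; lra.
Qed.

(** Sequences whose partial sums stay at bounded distance have the same mean; this covers
    shifts of the index and changes of finitely many terms. *)
Lemma has_mean_perturb (u v : nat -> C) (c : C) (K : R) :
  (forall N, Cmod (Csum v N - Csum u N) <= K) -> has_mean u c -> has_mean v c.
Proof.
  intros HK Hu e He.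
  destruct (Hu (e / 2)) as [N HN]; [lra |].
  destruct (INR_eventually_ge K (e / 2)) as [M HM]; [lra |].
  exists (N + M)%nat. intros n Hn.
  specialize (HN n ltac:(lia)). specialize (HM n ltac:(lia)). specialize (HK n).
  pose proof (Cmod_triangle_sub (Csum v n) (Csum u n) (INR n * c)). lra.
Qed.

Lemma has_mean_0_of_bounded (u : nat -> C) (K : R) :
  (forall N, Cmod (Csum u N) <= K) -> has_mean u 0.
Proof.
  intros HK e He. destruct (INR_eventually_ge K e He) as [M HM].
  exists M. intros n Hn. specialize (HM n Hn). specialize (HK n).
  replace (Csum u n - INR n * 0)%C with (Csum u n) by ring. lra.
Qed.

Lemma has_mean_const (c : C) : has_mean (fun _ => c) c.
Proof.
  intros e He. exists O. intros N _.
  replace (Csum (fun _ => c) N) with (INR N * c)%C.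
  - replace (INR N * c - INR N * c)%C with (RtoC 0) by ring. rewrite Cmod_0.
    pose proof (pos_INR N); nra.
  - induction N as [| N IH]; [simpl; ring |].
    rewrite S_INR, RtoC_plus. simpl. rewrite <- IH. ring.
Qed.

Lemma has_mean_Csum (v : nat -> nat -> C) (c : nat -> C) (N : nat) :
  (forall i, has_mean (v i) (c i)) ->
  has_mean (fun n => Csum (fun i => v i n) N) (Csum c N).
Proof.
  intros H. induction N as [| N IH]; simpl.
  - apply has_mean_const.
  - apply has_mean_plus; auto.
Qed.

Lemma has_mean_of_Ctends (u : nat -> C) (l : C) : Ctends u l -> has_mean u l.
Proof.
  intros H e He. destruct (H (e / 2)) as [N HN]; [lra |].
  set (K := Cmod (Csum u N - INR N * l)).
  destruct (INR_eventually_ge K (e / 2)) as [N1 HN1]; [lra |].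
  assert (A : forall m, Cmod (Csum u (N + m) - INR (N + m) * l) <= K + e / 2 * INR m).
  { induction m as [| m IH].
    - rewrite Nat.add_0_r. simpl. unfold K. lra.
    - rewrite Nat.add_succ_r, !S_INR, RtoC_plus. simpl Csum.
      replace (Csum u (N + m) + u (N + m)%nat - (INR (N + m) + 1) * l)%C
        with ((Csum u (N + m) - INR (N + m) * l) + (u (N + m)%nat - l))%C by ring.
      eapply Rle_trans; [apply Cmod_triangle |].
      specialize (HN (N + m)%nat ltac:(lia)). lra. }
  exists (N + N1)%nat. intros n Hn. specialize (A (n - N)%nat).
  replace (N + (n - N))%nat with n in A by lia.
  specialize (HN1 n ltac:(lia)).
  assert (INR (n - N) <= INR n) by (apply le_INR; lia). nra.
Qed.

Lemma has_mean_unique (u : nat -> C) (c d : C) : has_mean u c -> has_mean u d -> c = d.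
Proof.
  intros Hc Hd. apply Ceq_minus, Cmod_eq_0_of_small. intros e He.
  destruct (Hc (e / 2)) as [N HN]; [lra |]. destruct (Hd (e / 2)) as [M HM]; [lra |].
  set (n := S (N + M)).
  specialize (HN n ltac:(lia)). specialize (HM n ltac:(lia)).
  assert (Hn : 0 < INR n) by (apply lt_0_INR; lia).
  pose proof (Cmod_triangle_sub (INR n * c) (Csum u n) (INR n * d)) as T.
  rewrite (Cmod_minus_sym (INR n * c)%C (Csum u n)) in T.
  replace (INR n * c - INR n * d)%C with (INR n * (c - d))%C in T by ring.
  rewrite Cmod_mult, Cmod_R, Rabs_pos_eq in T by lra.
  apply Rmult_le_reg_l with (INR n); [assumption | lra].
Qed.

Lemma Csum_shift_close (u : nat -> C) (B : R) (k N : nat) :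
  (forall n, Cmod (u n) <= B) ->
  Cmod (Csum (fun n => u (k + n)%nat) N - Csum u N) <= 2 * B * INR k.
Proof.
  intros HB.
  assert (E : Csum (fun n => u (k + n)%nat) N
              = (Csum u N + Csum (fun n => u (N + n)%nat) k - Csum u k)%C).
  { rewrite <- Csum_add, Nat.add_comm, Csum_add. ring. }
  rewrite E.
  replace (Csum u N + Csum (fun n => u (N + n)%nat) k - Csum u k - Csum u N)%C
    with (Csum (fun n => u (N + n)%nat) k + - Csum u k)%C by ring.
  eapply Rle_trans; [apply Cmod_triangle |]. rewrite Cmod_opp.
  assert (S1 : Cmod (Csum (fun n => u (N + n)%nat) k) <= Rsum (fun _ => B) k)
    by (apply Csum_Cmod_le; auto).
  assert (S2 : Cmod (Csum u k) <= Rsum (fun _ => B) k) by (apply Csum_Cmod_le; auto).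
  rewrite Rsum_const in S1, S2. lra.
Qed.

Lemma has_mean_shift (u : nat -> C) (B : R) (k : nat) (c : C) :
  (forall n, Cmod (u n) <= B) ->
  has_mean (fun n => u (k + n)%nat) c <-> has_mean u c.
Proof.
  intros HB. split; apply has_mean_perturb with (2 * B * INR k); intros N.
  - rewrite Cmod_minus_sym. apply Csum_shift_close; assumption.
  - apply Csum_shift_close; assumption.
Qed.

(** Positivity of the mean, in the form of domination by a real sequence. *)
Lemma has_mean_le (u : nat -> C) (v : nat -> R) (c : C) (d : R) :
  (forall n, Cmod (u n) <= v n) -> has_mean u c -> has_mean (fun n => RtoC (v n)) d ->
  Cmod c <= d.
Proof.
  intros Huv Hu Hv. apply le_epsilon; intros e He.
  destruct (Hu (e / 2)) as [N HN]; [lra |]. destruct (Hv (e / 2)) as [M HM]; [lra |].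
  set (n := S (N + M)).
  specialize (HN n ltac:(lia)). specialize (HM n ltac:(lia)).
  rewrite Csum_RtoC, <- RtoC_mult, <- RtoC_minus, Cmod_R in HM.
  apply Rabs_le_between in HM.
  assert (S1 : Cmod (Csum u n) <= Rsum v n) by (apply Csum_Cmod_le; auto).
  assert (Hn : 0 < INR n) by (apply lt_0_INR; lia).
  apply Rmult_le_reg_l with (INR n); [assumption |].
  pose proof (Cmod_le_of_close (INR n * c) (Csum u n)) as T.
  rewrite Cmod_mult, Cmod_R, (Rabs_pos_eq (INR n)), Cmod_minus_sym in T by lra.
  nra.
Qed.

Lemma has_mean_of_approx (u : nat -> C) (c : C) :
  (forall eps, 0 < eps -> exists (v : nat -> C) (d : C),
     has_mean v d /\ (forall n, Cmod (u n - v n) <= eps) /\ Cmod (d - c) <= eps) ->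
  has_mean u c.
Proof.
  intros H e He. destruct (H (e / 3)) as (v & d & Hv & Huv & Hd); [lra |].
  destruct (Hv (e / 3)) as [N HN]; [lra |].
  exists N. intros n Hn. specialize (HN n Hn). pose proof (pos_INR n).
  replace (Csum u n - INR n * c)%C
    with (Csum (fun k => u k + (-1) * v k)%C n + (Csum v n - INR n * d) + INR n * (d - c))%C
    by (rewrite Csum_plus, Csum_scal; ring).
  eapply Rle_trans; [apply Cmod_triangle |].
  eapply Rle_trans; [apply Rplus_le_compat_r, Cmod_triangle |].
  rewrite Cmod_mult, Cmod_R, (Rabs_pos_eq (INR n)) by lra.
  assert (S1 : Cmod (Csum (fun k => u k + (-1) * v k)%C n) <= Rsum (fun _ => e / 3) n).
  { apply Csum_Cmod_le. intros k _. replace (u k + -1 * v k)%C with (u k - v k)%C by ring.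
    auto. }
  rewrite Rsum_const in S1. nra.
Qed.

(** The partial sums are geometric, hence bounded by [2 / |expi b - 1|]. *)
Lemma has_mean_expi (b : R) : expi b <> 1 -> has_mean (fun n => expi (INR n * b)) 0.
Proof.
  intros Hb.
  assert (Hp : 0 < Cmod (expi b - 1)).
  { apply Cmod_gt_0. intros F. apply Hb. apply Ceq_minus. assumption. }
  apply has_mean_0_of_bounded with (2 / Cmod (expi b - 1)). intros N.
  assert (E : (Csum (fun n => expi (INR n * b)) N * (expi b - 1))%C = (expi (INR N * b) - 1)%C).
  { induction N as [| N IH].
    - simpl. rewrite Rmult_0_l, expi_0. ring.
    - rewrite S_INR, Rmult_plus_distr_r, Rmult_1_l, expi_add. simpl.
      rewrite Cmult_plus_distr_r, IH. ring. }
  apply Rmult_le_reg_r with (Cmod (expi b - 1)); [assumption |].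
  rewrite <- Cmod_mult, E. unfold Rdiv. rewrite Rmult_assoc, Rinv_l, Rmult_1_r by lra.
  unfold Cminus. eapply Rle_trans; [apply Cmod_triangle |].
  rewrite Cmod_opp, Cmod_expi, Cmod_1. lra.
Qed.

(** If all windows of length [N] have nearly the same sum, then a window of length [M N] can
    be cut into [M] windows of length [N] or into [N] windows of length [M]; so the averages
    of lengths [M] and [N] are close, and the averages form a Cauchy sequence. *)
Lemma has_mean_exists (u : nat -> C) :
  (forall eps, 0 < eps -> exists N0, forall N i, (N0 <= N)%nat ->
     Cmod (Csum (fun n => u (i + n)%nat) N - Csum u N) <= eps * INR N) ->
  exists c, has_mean u c.
Proof.
  intros H.
  assert (A : forall eps N M, (forall i,
      Cmod (Csum (fun n => u (i + n)%nat) N - Csum u N) <= eps * INR N) ->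
      Cmod (Csum u (M * N) - INR M * Csum u N) <= INR M * (eps * INR N)).
  { intros e N M HN. induction M as [| M IH].
    - simpl. replace (0 - 0 * Csum u N)%C with (RtoC 0) by ring. rewrite Cmod_0. lra.
    - replace (S M * N)%nat with (M * N + N)%nat by lia.
      rewrite Csum_add, S_INR, RtoC_plus.
      replace (Csum u (M * N) + Csum (fun n => u (M * N + n)%nat) N - (INR M + 1) * Csum u N)%C
        with ((Csum u (M * N) - INR M * Csum u N)
              + (Csum (fun n => u (M * N + n)%nat) N - Csum u N))%C by ring.
      eapply Rle_trans; [apply Cmod_triangle |]. specialize (HN (M * N)%nat). lra. }
  assert (Hc : exists c, Ctends (fun N => Csum u (S N) / INR (S N))%C c).
  { apply Ctends_cauchy. intros e He.
    destruct (H (e / 2)) as [N0 HN0]; [lra |].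
    exists N0. intros n m Hn Hm.
    assert (P1 := A (e / 2) (S n) (S m) (fun i => HN0 (S n) i ltac:(lia))).
    assert (P2 := A (e / 2) (S m) (S n) (fun i => HN0 (S m) i ltac:(lia))).
    rewrite (Nat.mul_comm (S n) (S m)) in P2.
    assert (Hn' : 0 < INR (S n)) by (apply lt_0_INR; lia).
    assert (Hm' : 0 < INR (S m)) by (apply lt_0_INR; lia).
    set (a := INR (S n)) in *. set (b := INR (S m)) in *.
    set (X := Csum u (S n)) in *. set (Y := Csum u (S m)) in *.
    assert (Q : Cmod (b * X - a * Y) <= a * b * e).
    { pose proof (Cmod_triangle_sub (b * X) (Csum u (S m * S n)) (a * Y)) as T.
      rewrite (Cmod_minus_sym (b * X)%C (Csum _ _)) in T. nra. }
    apply Rmult_le_reg_l with (a * b); [nra |].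
    replace (a * b) with (Cmod (a * b)%C) at 1.
    - rewrite <- Cmod_mult.
      replace (a * b * (X / a - Y / b))%C with (b * X - a * Y)%C; [assumption |].
      field. split; intros F; apply RtoC_inj in F; lra.
    - rewrite <- RtoC_mult, Cmod_R, Rabs_pos_eq; nra. }
  destruct Hc as [c Hc]. exists c. intros e He. destruct (Hc e He) as [N0 HN0].
  exists (S N0). intros N HN. destruct N as [| N]; [lia |].
  specialize (HN0 N ltac:(lia)).
  assert (Hn' : 0 < INR (S N)) by (apply lt_0_INR; lia).
  replace (Csum u (S N) - INR (S N) * c)%C with (INR (S N) * (Csum u (S N) / INR (S N) - c))%C.
  - rewrite Cmod_mult, Cmod_R, Rabs_pos_eq by lra. nra.
  - field. intros F; apply RtoC_inj in F; lra.
Qed.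

(** * Fejer kernels as local test functions *)

Fixpoint dirichlet (n : nat) (u : R) : R :=
  match n with O => 1 | S m => dirichlet m u + 2 * cos (INR (S m) * u) end.

(** This is [n] times the normalized Fejer kernel; its mean along an irrational rotation
    is [n]. *)
Fixpoint fejer (n : nat) (u : R) : R :=
  match n with O => 0 | S m => fejer m u + dirichlet m u end.

Lemma dirichlet_closed (n : nat) (u : R) :
  (1 - cos u) * dirichlet n u = cos (INR n * u) - cos (INR (S n) * u).
Proof.
  induction n as [| n IH].
  - simpl. rewrite Rmult_0_l, Rmult_1_l, cos_0; ring.
  - change (dirichlet (S n) u) with (dirichlet n u + 2 * cos (INR (S n) * u)).
    rewrite Rmult_plus_distr_l, IH.
    replace (INR n * u) with (INR (S n) * u - u) by (rewrite S_INR; ring).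
    replace (INR (S (S n)) * u) with (INR (S n) * u + u) by (rewrite (S_INR (S n)); ring).
    rewrite cos_minus, cos_plus. ring.
Qed.

Lemma fejer_closed (n : nat) (u : R) : (1 - cos u) * fejer n u = 1 - cos (INR n * u).
Proof.
  induction n as [| n IH].
  - simpl. rewrite Rmult_0_l, cos_0; ring.
  - simpl fejer. rewrite Rmult_plus_distr_l, IH, dirichlet_closed. ring.
Qed.

Lemma cos_INR_of_cos_1 (u : R) (n : nat) : cos u = 1 -> cos (INR n * u) = 1.
Proof.
  intros H. assert (Hs : sin u = 0).
  { pose proof (sin2_cos2 u) as K. unfold Rsqr in K. nra. }
  induction n as [| n IH].
  - simpl. rewrite Rmult_0_l. apply cos_0.
  - rewrite S_INR, Rmult_plus_distr_r, Rmult_1_l, cos_plus, IH, H, Hs. ring.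
Qed.

(** Away from [cos u = 1] this is the closed form; at [cos u = 1] all cosines in the kernel
    equal [1]. *)
Lemma fejer_nonneg (n : nat) (u : R) : 0 <= fejer n u.
Proof.
  pose proof (COS_bound u) as B.
  destruct (Req_dec (cos u) 1) as [H | H].
  - assert (D : forall m, 0 <= dirichlet m u).
    { induction m as [| m IH]; [simpl; lra |].
      change (dirichlet (S m) u) with (dirichlet m u + 2 * cos (INR (S m) * u)).
      rewrite cos_INR_of_cos_1 by assumption. lra. }
    induction n as [| n IH]; simpl; [lra |]. specialize (D n); lra.
  - apply Rmult_le_reg_l with (1 - cos u); [lra |].
    rewrite fejer_closed. pose proof (COS_bound (INR n * u)). lra.
Qed.

Lemma fejer_le_away (n : nat) (u eta : R) :
  0 < eta -> cos u <= 1 - eta -> fejer n u <= 2 / eta.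
Proof.
  intros He Hc. apply Rmult_le_reg_l with (1 - cos u); [lra |].
  rewrite fejer_closed. pose proof (COS_bound (INR n * u)).
  apply Rle_trans with (eta * (2 / eta)).
  - replace (eta * (2 / eta)) with 2 by (field; lra). lra.
  - apply Rmult_le_compat_r; [| lra]. apply Rlt_le, Rdiv_lt_0_compat; lra.
Qed.

(** The kernel is a trigonometric polynomial with constant coefficient [n], so only the
    character of index [0] contributes. *)
Lemma has_mean_fejer (x : nat -> R) (E : nat -> C) (e : C) (y : R) (n : nat) :
  has_mean E e ->
  (forall j : Z, j <> 0%Z -> has_mean (fun k => E k * expi (IZR j * x k))%C 0) ->
  has_mean (fun k => fejer n (x k - y) * E k)%C (INR n * e)%C.
Proof.
  intros H0 Hj.
  assert (D : forall m, has_mean (fun k => dirichlet m (x k - y) * E k)%C e).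
  { induction m as [| m IH].
    - eapply has_mean_ext; [| exact H0]. intros k; simpl; ring.
    - pose proof (has_mean_scal (expi (IZR (- Z.of_nat (S m)) * y)) _ _
                    (Hj (Z.of_nat (S m)) ltac:(lia))) as A.
      pose proof (has_mean_scal (expi (IZR (Z.of_nat (S m)) * y)) _ _
                    (Hj (- Z.of_nat (S m))%Z ltac:(lia))) as B.
      pose proof (has_mean_plus _ _ _ _ IH (has_mean_plus _ _ _ _ A B)) as T.
      replace e with (e + (expi (IZR (- Z.of_nat (S m)) * y) * 0
                           + expi (IZR (Z.of_nat (S m)) * y) * 0))%C by ring.
      eapply has_mean_ext; [| exact T]. intros k. cbv beta.
      change (dirichlet (S m) (x k - y))
        with (dirichlet m (x k - y) + 2 * cos (INR (S m) * (x k - y))).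
      rewrite RtoC_plus, expi_cos, opp_IZR, <- INR_IZR_INZ.
      replace (INR (S m) * (x k - y)) with (INR (S m) * x k + - INR (S m) * y) by ring.
      replace (- (INR (S m) * x k + - INR (S m) * y))
        with (- INR (S m) * x k + INR (S m) * y) by ring.
      rewrite !expi_add. ring. }
  induction n as [| n IH].
  - simpl. replace (0 * e)%C with (RtoC 0) by ring.
    eapply has_mean_ext; [| exact (has_mean_const 0)]. intros k; simpl; ring.
  - replace (INR (S n) * e)%C with (INR n * e + e)%C by (rewrite S_INR, RtoC_plus; ring).
    eapply has_mean_ext; [| exact (has_mean_plus _ _ _ _ IH (D n))].
    intros k; simpl fejer; rewrite RtoC_plus; ring.
Qed.

(** The [j]-th Fourier coefficient of [F], computed as a mean along the orbit instead of an
    integral. *)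
Definition fourier_mean (x0 tau : R) (F : R -> C) (j : Z) (c : C) : Prop :=
  has_mean (fun n => F (x0 + INR n * tau)%R * expi (IZR j * (x0 + INR n * tau)))%C c.

(** Multiply [h - E] by the Fejer kernel of order [n] centred at [y].  The product has mean
    [n h], since [E] is orthogonal to all characters, and it is dominated by [eps] times the
    kernel plus a constant that does not depend on [n], since the kernel is bounded by
    [2 / eta] away from [y].  Hence [n |h| <= eps n + K] for all [n]. *)
Lemma local_value_small_of_zero_means (x0 tau : R)
  (hirr : irrational_rotation tau)
  (E : R -> C) (B : R) (h : C) (eps eta y : R) :
  (forall t, Cmod (E t) <= B) ->
  (forall j : Z, fourier_mean x0 tau E j 0) ->
  0 < eta ->
  (forall t, 1 - eta < cos (t - y) -> Cmod (E t - h) <= eps) ->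
  Cmod h <= eps.
Proof.
  intros HB Hm Heta Hnear.
  assert (Hone : forall j : Z, j <> 0%Z ->
            has_mean (fun k => 1 * expi (IZR j * (x0 + INR k * tau)))%C 0).
  { intros j Hj. replace (RtoC 0) with (expi (IZR j * x0) * 0)%C by ring.
    eapply has_mean_ext; [| apply (has_mean_scal (expi (IZR j * x0))),
                              (has_mean_expi (tau * IZR j))].
    - intros k. cbv beta. rewrite <- expi_add.
      replace (IZR j * x0 + INR k * (tau * IZR j)) with (IZR j * (x0 + INR k * tau)) by ring.
      ring.
    - intros F. apply Hj, hirr, F. }
  set (K := (Cmod h + B) * (2 / eta)).
  assert (HhB : 0 <= Cmod h + B).
  { pose proof (Cmod_ge_0 h). pose proof (HB 0). pose proof (Cmod_ge_0 (E 0)). lra. }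
  assert (Hpos : 0 <= 2 / eta) by (apply Rlt_le, Rdiv_lt_0_compat; lra).
  assert (Main : forall n, INR n * Cmod h <= eps * INR n + K).
  { intros n.
    pose proof (has_mean_fejer (fun k => x0 + INR k * tau) (fun _ => RtoC 1) 1 y n
                  (has_mean_const 1) Hone) as M1.
    assert (HE0 : has_mean (fun k => E (x0 + INR k * tau)) 0).
    { eapply has_mean_ext; [| exact (Hm 0%Z)]. intros k. cbv beta.
      rewrite Rmult_0_l, expi_0. ring. }
    pose proof (has_mean_fejer (fun k => x0 + INR k * tau) (fun k => E (x0 + INR k * tau)) 0 y n
                  HE0 (fun j _ => Hm j)) as M2.
    pose proof (has_mean_plus _ _ _ _ (has_mean_scal h _ _ M1) (has_mean_scal (-1) _ _ M2)) as M3.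
    pose proof (has_mean_plus _ _ _ _ (has_mean_scal eps _ _ M1) (has_mean_const K)) as M4.
    cbv beta in M3, M4.
    assert (G : Cmod (h * (INR n * 1) + -1 * (INR n * 0))%C <= eps * INR n + K).
    { eapply has_mean_le; [| exact M3 |].
      2: { eapply has_mean_ext with (v := fun k => RtoC (eps * fejer n (x0 + INR k * tau - y) + K)) in M4.
           - replace (RtoC (eps * INR n + K)) with (eps * (INR n * 1) + K)%C; [exact M4 |].
             rewrite RtoC_plus, RtoC_mult; ring.
           - intros k. rewrite RtoC_plus, RtoC_mult; ring. }
      intros k. cbv beta. set (t := x0 + INR k * tau).
      replace (h * (fejer n (t - y) * 1) + -1 * (fejer n (t - y) * E t))%C
        with (fejer n (t - y) * (h - E t))%C by ring.
      pose proof (fejer_nonneg n (t - y)) as Fp.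
      rewrite Cmod_mult, Cmod_R, Rabs_pos_eq by assumption.
      destruct (Rlt_le_dec (1 - eta) (cos (t - y))) as [L | L].
      - specialize (Hnear t L). rewrite Cmod_minus_sym in Hnear.
        assert (0 <= K) by (apply Rmult_le_pos; assumption). nra.
      - pose proof (fejer_le_away n (t - y) eta Heta L) as Fa.
        assert (Cmod (h - E t) <= Cmod h + B).
        { unfold Cminus. eapply Rle_trans; [apply Cmod_triangle |].
          rewrite Cmod_opp. specialize (HB t). lra. }
        assert (He : 0 <= eps).
        { specialize (Hnear y). rewrite Rminus_diag, cos_0 in Hnear.
          pose proof (Cmod_ge_0 (E y - h)). specialize (Hnear ltac:(lra)). lra. }
        apply Rle_trans with K; [| nra].
        unfold K. rewrite Rmult_comm.
        apply Rmult_le_compat; try assumption. apply Cmod_ge_0. }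
    replace (h * (INR n * 1) + -1 * (INR n * 0))%C with (INR n * h)%C in G by ring.
    rewrite Cmod_mult, Cmod_R, Rabs_pos_eq in G by apply pos_INR. exact G. }
  destruct (Rle_lt_dec (Cmod h) eps) as [L | L]; [assumption | exfalso].
  destruct (INR_eventually_ge (K + 1) (Cmod h - eps)) as [n Hn]; [lra |].
  specialize (Hn n (le_n n)). specialize (Main n). nra.
Qed.

(** The hypothesis asks for points [y], anywhere, around which [H] is uniformly close to
    [h]; a one-sided limit at [t] provides them on that side of [t]. *)
Lemma one_sided_limit_zero (x0 tau : R)
  (hirr : irrational_rotation tau)
  (H : R -> C) (B : R) (h : C) :
  (forall x, Cmod (H x) <= B) ->
  periodic_2PI H ->
  (forall j : Z, fourier_mean x0 tau H j 0) ->
  (forall eps, 0 < eps -> exists y rho, 0 < rho /\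
     forall x, Rabs (x - y) < rho -> Cmod (H x - h) <= eps) ->
  h = 0.
Proof.
  intros HB Hper Hm Hnear. apply Cmod_eq_0_of_small. intros e He.
  destruct (Hnear e He) as (y & rho & Hr & Hy).
  destruct (cos_near_1 (Rmin rho PI)) as (eta & Heta & Hc).
  { pose proof PI_RGT_0. split; [apply Rmin_glb_lt; assumption | apply Rmin_r]. }
  apply (local_value_small_of_zero_means x0 tau hirr H B h e eta y HB Hm Heta).
  intros x Hx. destruct (Hc (x - y) Hx) as [k Hk].
  rewrite <- (Hper x k). apply Hy. pose proof (Rmin_l rho PI).
  replace (x + 2 * PI * IZR k - y) with (x - y + 2 * PI * IZR k) by ring. lra.
Qed.

(** * Existence of means along an irrational rotation *)

Definition visit (delta : R) (d : C) (x : R) : R :=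
  if Rlt_dec (Cmod (expi x - d)) delta then 1 else 0.

Lemma finite_positive_lower_bound (v : nat -> R) (K : nat) :
  (forall k, (k < K)%nat -> 0 < v k) ->
  exists delta, 0 < delta /\ forall k, (k < K)%nat -> delta <= v k.
Proof.
  induction K as [| K IH]; intros H.
  - exists 1. split; [lra | intros; lia].
  - destruct IH as (d & Hd & Hk); [auto with arith |].
    exists (Rmin d (v K)). split.
    + apply Rmin_glb_lt; auto with arith.
    + intros k Hk'. destruct (Nat.eq_dec k K) as [-> | Hn].
      * apply Rmin_r.
      * eapply Rle_trans; [apply Rmin_l | apply Hk; lia].
Qed.

(** Among [K] consecutive points of the orbit at most one is within [delta] of [d], provided
    [2 delta] is below every [|expi (k tau) - 1|], [1 <= k <= K].  So the frequency of visits
    is at most [1 / K]. *)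
Lemma visits_are_rare (tau : R)
  (hirr : irrational_rotation tau) (eps : R) :
  0 < eps ->
  exists delta, 0 < delta /\ forall d x N,
    Rsum (fun n => visit delta d (x + INR n * tau)) N <= eps * INR N + 1.
Proof.
  intros He. destruct (INR_eventually_ge 1 eps He) as [K0 HK0].
  set (K := S K0). assert (HK : 1 <= eps * INR K) by (apply HK0; lia).
  destruct (finite_positive_lower_bound
              (fun k => Cmod (expi (INR (S k) * tau) - 1) / 2) K) as (delta & Hd & Hk).
  { intros k _. apply Rdiv_lt_0_compat; [| lra]. apply Cmod_gt_0. intros F.
    apply Ceq_minus in F. rewrite INR_IZR_INZ, Rmult_comm in F. apply hirr in F. lia. }
  exists delta. split; [assumption |]. intros d.
  assert (Block : forall x N, (N <= K)%nat ->
            Rsum (fun n => visit delta d (x + INR n * tau)) N <= 1).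
  { intros x. induction N as [| N IH]; intros HN; [simpl; lra |].
    simpl Rsum. unfold visit at 2. destruct (Rlt_dec _ _) as [V | V].
    2: { specialize (IH ltac:(lia)). lra. }
    assert (Z : Rsum (fun n => visit delta d (x + INR n * tau)) N <= Rsum (fun _ => 0) N).
    { apply Rsum_le. intros n Hn. unfold visit. destruct (Rlt_dec _ _) as [W | W]; [| lra].
      exfalso. specialize (Hk (N - n - 1)%nat ltac:(lia)).
      replace (S (N - n - 1)) with (N - n)%nat in Hk by lia.
      rewrite minus_INR in Hk by lia.
      assert (E : (expi (x + INR N * tau) - expi (x + INR n * tau))%C
                  = (expi (x + INR n * tau) * (expi ((INR N - INR n) * tau) - 1))%C).
      { replace (x + INR N * tau) with ((x + INR n * tau) + (INR N - INR n) * tau) by ring.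
        rewrite (expi_add (x + INR n * tau)). ring. }
      apply (f_equal Cmod) in E. rewrite Cmod_mult, Cmod_expi, Rmult_1_l in E.
      pose proof (Cmod_triangle_sub (expi (x + INR N * tau)) d (expi (x + INR n * tau))) as T.
      rewrite (Cmod_minus_sym d) in T. lra. }
    rewrite Rsum_const in Z. lra. }
  (* Cut a stretch of length [N] into blocks of length [K]; a shorter last block may
     contain one visit, whence the additive constant [1]. *)
  assert (All : forall m N x, (N <= m * K)%nat ->
            Rsum (fun n => visit delta d (x + INR n * tau)) N <= eps * INR N + 1).
  { induction m as [| m IH]; intros N x HN.
    - replace N with O by lia. simpl. lra.
    - destruct (Nat.le_gt_cases N K) as [L | L].
      + specialize (Block x N L). pose proof (pos_INR N). nra.
      + replace N with (K + (N - K))%nat by lia. rewrite Rsum_add, plus_INR.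
        specialize (Block x K (le_n K)).
        specialize (IH (N - K)%nat (x + INR K * tau) ltac:(lia)).
        assert (E : Rsum (fun n => visit delta d (x + INR (K + n) * tau)) (N - K)
                    <= Rsum (fun n => visit delta d (x + INR K * tau + INR n * tau)) (N - K)).
        { apply Rsum_le. intros n _. right. f_equal. rewrite plus_INR. ring. }
        lra. }
  intros x N. apply (All N). unfold K. nia.
Qed.

Definition near_list (l : list C) (delta x : R) : Prop :=
  exists d, In d l /\ Cmod (expi x - d) < delta.

(** The function [w] dominates the indicator of the [delta]-neighbourhood of [l]; summing
    it over the orbit counts the visits. *)
Lemma near_list_rare (tau : R)
  (hirr : irrational_rotation tau) (l : list C) (eps : R) :
  0 < eps ->
  exists (delta K : R) (w : R -> R), 0 < delta /\
    (forall x, 0 <= w x) /\ (forall x, near_list l delta x -> 1 <= w x) /\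
    forall x N, Rsum (fun n => w (x + INR n * tau)) N <= eps * INR N + K.
Proof.
  revert eps. induction l as [| d l IH]; intros eps He.
  - exists 1, 0, (fun _ => 0). split; [lra | split; [intros; lra | split]].
    + intros x (d & Hin & _); destruct Hin.
    + intros x N. rewrite Rsum_const. pose proof (pos_INR N). nra.
  - destruct (IH (eps / 2)) as (de1 & K & w & Hd1 & Hw & Hn & Hs); [lra |].
    destruct (visits_are_rare tau hirr (eps / 2)) as (de2 & Hd2 & Hv); [lra |].
    exists (Rmin de1 de2), (K + 1), (fun x => w x + visit de2 d x).
    assert (Hv0 : forall x, 0 <= visit de2 d x).
    { intros x. unfold visit. destruct (Rlt_dec _ _); lra. }
    split; [| split; [| split]].
    + apply Rmin_glb_lt; assumption.
    + intros x. specialize (Hw x). specialize (Hv0 x). lra.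
    + intros x (d' & [<- | Hin] & Hc).
      * unfold visit. specialize (Hw x). pose proof (Rmin_r de1 de2).
        destruct (Rlt_dec _ _); lra.
      * specialize (Hv0 x). pose proof (Rmin_l de1 de2).
        assert (1 <= w x); [| lra]. apply Hn. exists d'. split; [assumption | lra].
    + intros x N. rewrite Rsum_plus. specialize (Hs x N). specialize (Hv d x N). lra.
Qed.

Definition cont_at (G : R -> C) (x : R) : Prop :=
  forall eps, 0 < eps ->
    exists delta, 0 < delta /\ forall y, Rabs (y - x) < delta -> Cmod (G y - G x) <= eps.

Definition continuous_off (l : list C) (G : R -> C) : Prop :=
  forall x, ~ In (expi x) l -> cont_at G x.

(** Compactness of [[0, 2 PI]], each point being given a radius on which either all points
    are near [l] or [G] varies by less than [eps / 2]. *)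
Lemma uniformly_continuous_off (l : list C) (G : R -> C) (delta eps : R) :
  periodic_2PI G ->
  continuous_off l G -> 0 < delta -> 0 < eps ->
  exists rho, 0 < rho /\ forall x y,
    ~ near_list l delta x -> Rabs (x - y) < rho -> Cmod (G x - G y) <= eps.
Proof.
  intros Hper Hcont Hd He.
  assert (HR : forall x, exists r : posreal,
    (forall y, Rabs (y - x) < r -> near_list l delta y) \/
    (forall y, Rabs (y - x) < 2 * r -> Cmod (G y - G x) <= eps / 2)).
  { intros x. destruct (classic (In (expi x) l)) as [Hin | Hin].
    - exists (mkposreal delta Hd). left. intros y Hy. exists (expi x). split; [assumption |].
      eapply Rle_lt_trans; [apply Cmod_expi_minus_le | exact Hy].
    - destruct (Hcont x Hin (eps / 2)) as (r & Hr & Hy); [lra |].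
      assert (Hr2 : 0 < r / 2) by lra. exists (mkposreal _ Hr2). right. simpl.
      intros y H. apply Hy. lra. }
  destruct (functional_choice _ HR) as [r Hr].
  destruct (compactness_value_1d 0 (2 * PI) r) as [rho Hrho].
  exists rho. split; [apply cond_pos |]. intros x y Hn Hxy.
  destruct (reduce_mod_2PI x) as [k Hk].
  rewrite <- (Hper x k), <- (Hper y k).
  assert (Hn' : ~ near_list l delta (x + 2 * PI * IZR k)).
  { intros (d & Hin & Hc). apply Hn. exists d. rewrite expi_period in Hc. auto. }
  assert (Hxy' : Rabs (x + 2 * PI * IZR k - (y + 2 * PI * IZR k)) < rho).
  { replace (x + 2 * PI * IZR k - (y + 2 * PI * IZR k)) with (x - y) by ring. assumption. }
  set (x' := x + 2 * PI * IZR k) in *. set (y' := y + 2 * PI * IZR k) in *.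
  apply NNPP. intros Hfail. apply (Hrho x'); [lra |]. intros (t & _ & Ht & Hle).
  apply Hfail. destruct (Hr t) as [A | A].
  - elim Hn'. apply A. assumption.
  - assert (B1 := A x' ltac:(pose proof (cond_pos (r t)); lra)).
    assert (B2 := A y' ltac:(apply Rabs_def2 in Ht; apply Rabs_def2 in Hxy'; apply Rabs_def1; lra)).
    pose proof (Cmod_triangle_sub (G x') (G t) (G y')) as T.
    rewrite (Cmod_minus_sym (G t) (G y')) in T. lra.
Qed.

(** Cut the range into cells of length [delta]; [M] bounds the first visits to the cells
    that are visited at all. *)
Lemma bounded_sequence_recurs (y : nat -> R) (delta : R) (n : nat) :
  exists M, forall i, 0 <= y i < INR n * delta ->
    exists m, (m <= M)%nat /\ Rabs (y i - y m) < delta.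
Proof.
  induction n as [| n [M IH]].
  - exists O. simpl. intros i Hi. lra.
  - rewrite S_INR.
    destruct (classic (exists m0, INR n * delta <= y m0 < (INR n + 1) * delta)) as [[m0 H0] | H0].
    + exists (M + m0)%nat. intros i Hi.
      destruct (Rlt_le_dec (y i) (INR n * delta)) as [L | L].
      * destruct (IH i) as (m & Hm & Ha); [lra |]. exists m. split; [lia | assumption].
      * exists m0. split; [lia |]. apply Rabs_def1; lra.
    + exists M. intros i Hi. apply IH. split; [lra |].
      apply Rnot_le_lt. intros F. apply H0. exists i. lra.
Qed.

Lemma rotation_recurs (tau delta : R) : 0 < delta ->
  exists M, forall i, exists (m : nat) (k : Z), (m <= M)%nat /\
    Rabs (INR i * tau - INR m * tau - 2 * PI * IZR k) < delta.
Proof.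
  intros Hd.
  destruct (functional_choice _ (fun i : nat => reduce_mod_2PI (INR i * tau))) as [k Hk].
  destruct (INR_eventually_ge (2 * PI) delta Hd) as [n Hn]. specialize (Hn n (le_n n)).
  destruct (bounded_sequence_recurs (fun i => INR i * tau + 2 * PI * IZR (k i)) delta n) as [M HM].
  exists M. intros i. destruct (HM i) as (m & Hm & Ha).
  - specialize (Hk i). lra.
  - exists m, (k m - k i)%Z. split; [assumption |]. rewrite minus_IZR.
    replace (INR i * tau - INR m * tau - 2 * PI * (IZR (k m) - IZR (k i)))
      with (INR i * tau + 2 * PI * IZR (k i) - (INR m * tau + 2 * PI * IZR (k m))) by ring.
    assumption.
Qed.

(** Windows of length [N] starting at [i] and at [0] have nearly the same sum.  By recurrence
    the start [i] can be replaced by a start [m <= M], with [M] independent of [i], where the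
    orbit is [rho]-close to the orbit started at [i]; uniform continuity compares the terms,
    except for the rare visits near the discontinuities, where boundedness is used.  Moving
    from [m] to [0] changes at most [2 M] terms. *)
Lemma orbit_mean_exists (x0 tau : R)
  (hirr : irrational_rotation tau)
  (G : R -> C) (B : R) (l : list C) :
  (forall x, Cmod (G x) <= B) ->
  periodic_2PI G ->
  continuous_off l G ->
  exists c, has_mean (fun n => G (x0 + INR n * tau)) c.
Proof.
  intros HB Hper Hcont. apply has_mean_exists. intros e He.
  assert (HB0 : 0 <= B) by (pose proof (HB 0); pose proof (Cmod_ge_0 (G 0)); lra).
  (* A visit near a discontinuity costs at most [2 B], so a frequency [e2] of visits
     costs at most [e / 3]. *)
  set (e2 := e / (6 * (B + 1))).
  assert (He2 : 0 < e2) by (apply Rdiv_lt_0_compat; lra).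
  assert (HBe : 2 * B * e2 <= e / 3).
  { replace (e / 3) with (2 * (B + 1) * e2) by (unfold e2; field; lra). nra. }
  destruct (near_list_rare tau hirr l e2 He2) as (delta & K & w & Hdel & Hw & Hnear & Hsum).
  destruct (uniformly_continuous_off l G delta (e / 3) Hper Hcont Hdel) as (rho & Hrho & Hunif);
    [lra |].
  destruct (rotation_recurs tau rho Hrho) as [M HM].
  destruct (INR_eventually_ge (2 * B * K + 2 * B * INR M) (e / 3)) as [N0 HN0]; [lra |].
  exists N0. intros N i HN. specialize (HN0 N HN).
  destruct (HM i) as (m & k & Hm & Ha).
  assert (Sm := Csum_shift_close (fun n => G (x0 + INR n * tau)) B m N (fun n => HB _)).
  cbv beta in Sm.
  assert (Si : Cmod (Csum (fun n => G (x0 + INR (i + n) * tau)%R) N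
                     - Csum (fun n => G (x0 + INR (m + n) * tau)%R) N)
               <= INR N * (e / 3) + 2 * B * (e2 * INR N + K)).
  { replace (Csum (fun n => G (x0 + INR (i + n) * tau)%R) N
             - Csum (fun n => G (x0 + INR (m + n) * tau)%R) N)%C
      with (Csum (fun n => G (x0 + INR (i + n) * tau)%R + (-1) * G (x0 + INR (m + n) * tau)%R)%C N)
      by (rewrite Csum_plus, Csum_scal; ring).
    eapply Rle_trans.
    - apply Csum_Cmod_le with
        (v := fun n => e / 3 + 2 * B * w ((x0 + INR m * tau) + INR n * tau)).
      intros n _. rewrite !plus_INR.
      set (a := x0 + (INR i + INR n) * tau).
      replace (x0 + INR m * tau + INR n * tau) with (x0 + (INR m + INR n) * tau) by ring.
      set (b := x0 + (INR m + INR n) * tau).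
      replace (G a + -1 * G b)%C with (G a - G b)%C by ring.
      specialize (Hw b).
      destruct (classic (near_list l delta b)) as [Hb | Hb].
      + specialize (Hnear b Hb).
        assert (Cmod (G a - G b) <= 2 * B).
        { unfold Cminus. eapply Rle_trans; [apply Cmod_triangle |]. rewrite Cmod_opp.
          pose proof (HB a); pose proof (HB b); lra. }
        nra.
      + rewrite Cmod_minus_sym, <- (Hper b k).
        assert (Hbk : ~ near_list l delta (b + 2 * PI * IZR k)).
        { intros (d & Hin & Hc). apply Hb. exists d. rewrite expi_period in Hc. auto. }
        assert (Hab : Rabs (b + 2 * PI * IZR k - a) < rho).
        { rewrite Rabs_minus_sym. unfold a, b.
          replace (x0 + (INR i + INR n) * tau - (x0 + (INR m + INR n) * tau + 2 * PI * IZR k))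
            with (INR i * tau - INR m * tau - 2 * PI * IZR k) by ring. assumption. }
        specialize (Hunif _ a Hbk Hab). nra.
    - rewrite Rsum_plus, Rsum_const, Rsum_scal. specialize (Hsum (x0 + INR m * tau) N). nra. }
  pose proof (Cmod_triangle_sub (Csum (fun n => G (x0 + INR (i + n) * tau)%R) N)
     (Csum (fun n => G (x0 + INR (m + n) * tau)%R) N) (Csum (fun n => G (x0 + INR n * tau)%R) N)) as T.
  assert (INR m <= INR M) by (apply le_INR; assumption).
  pose proof (pos_INR N). nra.
Qed.

Lemma orbit_mean_translate (x0 tau B : R) (G : R -> C) (c : C) (k : Z) :
  (forall x, Cmod (G x) <= B) ->
  has_mean (fun n => G (x0 + INR n * tau)) c ->
  has_mean (fun n => G (x0 + INR n * tau - tau * IZR k)) c.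
Proof.
  intros HB H. destruct (Z.le_gt_cases 0 k) as [Hk | Hk].
  - apply (has_mean_shift _ B (Z.to_nat k)); [intros; apply HB |].
    eapply has_mean_ext; [| exact H]. intros n. cbv beta. f_equal.
    rewrite plus_INR, !INR_IZR_INZ, Z2Nat.id by assumption. ring.
  - apply (has_mean_shift _ B (Z.to_nat (- k))) in H; [| intros; apply HB].
    eapply has_mean_ext; [| exact H]. intros n. cbv beta. f_equal.
    rewrite plus_INR, !INR_IZR_INZ, Z2Nat.id, opp_IZR by lia. ring.
Qed.

(** * Summable coefficients whose Fourier series vanishes off an arc *)

Lemma inv_square_partial_sum_le (N M : nat) :
  Rsum (fun n => / (INR (N + n) + 1) ^ 2) M <= 2 / (INR N + 1).
Proof.
  pose proof (pos_INR N) as HN.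
  assert (A : Rsum (fun n => / (INR (N + n) + 1) ^ 2) M
              <= 2 / (INR N + 1) - 2 / (INR (N + M) + 1)).
  { induction M as [| M IH].
    - simpl. rewrite Nat.add_0_r. lra.
    - rewrite Nat.add_succ_r, S_INR. cbn [Rsum].
      set (a := INR (N + M)) in *. assert (0 <= a) by apply pos_INR.
      assert (/ (a + 1) ^ 2 <= 2 / (a + 1) - 2 / (a + 1 + 1)); [| lra].
      replace (2 / (a + 1) - 2 / (a + 1 + 1)) with (2 / ((a + 1) * (a + 2)))
        by (field; repeat split; lra).
      apply Rmult_le_reg_l with ((a + 1) ^ 2 * (a + 2)); [apply Rmult_lt_0_compat; nra |].
      replace ((a + 1) ^ 2 * (a + 2) * / (a + 1) ^ 2) with (a + 2) by (field; lra).
      replace ((a + 1) ^ 2 * (a + 2) * (2 / ((a + 1) * (a + 2)))) with (2 * (a + 1))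
        by (field; lra). lra. }
  assert (0 < 2 / (INR (N + M) + 1)).
  { apply Rdiv_lt_0_compat; [lra |]. pose proof (pos_INR (N + M)); lra. }
  lra.
Qed.

Lemma Csum_inv_square_tail (t : nat -> C) (B : R) (N M : nat) :
  (forall n, Cmod (t n) <= B / (INR n + 1) ^ 2) -> (N <= M)%nat ->
  Cmod (Csum t M - Csum t N) <= 2 * B / (INR N + 1).
Proof.
  intros Ht HNM.
  assert (HB : 0 <= B).
  { specialize (Ht O). simpl in Ht. pose proof (Cmod_ge_0 (t O)). lra. }
  replace M with (N + (M - N))%nat by lia. rewrite Csum_add.
  replace (Csum t N + Csum (fun n => t (N + n)%nat) (M - N) - Csum t N)%C
    with (Csum (fun n => t (N + n)%nat) (M - N)) by ring.
  eapply Rle_trans.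
  - apply Csum_Cmod_le with (v := fun n => B * / (INR (N + n) + 1) ^ 2). intros n _. apply Ht.
  - rewrite Rsum_scal. pose proof (inv_square_partial_sum_le N (M - N)).
    replace (2 * B / (INR N + 1)) with (B * (2 / (INR N + 1))).
    + apply Rmult_le_compat_l; assumption.
    + field. pose proof (pos_INR N); lra.
Qed.

Lemma inv_square_series_converges (t : nat -> C) (B : R) :
  (forall n, Cmod (t n) <= B / (INR n + 1) ^ 2) ->
  exists l, Ctends (Csum t) l.
Proof.
  intros Ht. apply Ctends_cauchy. intros e He.
  assert (HB : 0 <= B).
  { specialize (Ht O). simpl in Ht. pose proof (Cmod_ge_0 (t O)). lra. }
  destruct (inv_INR_small (2 * B) e) as [N0 HN0]; [lra | assumption |].
  exists N0. intros n m Hn Hm. destruct (Nat.le_gt_cases n m) as [L | L].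
  - rewrite Cmod_minus_sym. eapply Rle_trans; [apply (Csum_inv_square_tail t B); assumption |].
    auto.
  - eapply Rle_trans; [apply (Csum_inv_square_tail t B); [assumption | lia] |]. auto.
Qed.

(** Partial Fourier sums of a quadratic polynomial on [(0, 2 PI)], a multiple of the second
    Bernoulli polynomial. *)
Fixpoint bernoulli_sum (n : nat) (x : R) : R :=
  match n with O => 0 | S m => bernoulli_sum m x + 2 * cos (INR (S m) * x) / INR (S m) ^ 2 end.

Fixpoint bernoulli_sum' (n : nat) (x : R) : R :=
  match n with O => 0 | S m => bernoulli_sum' m x - 2 * sin (INR (S m) * x) / INR (S m) end.

Lemma bernoulli_sum_deriv (n : nat) (x : R) :
  derivable_pt_lim (bernoulli_sum n) x (bernoulli_sum' n x).
Proof.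
  apply is_derive_Reals. induction n as [| n IH].
  - apply @is_derive_const.
  - assert (Hn : INR (S n) <> 0) by (apply not_0_INR; lia).
    change (is_derive (fun y => bernoulli_sum n y + 2 * cos (INR (S n) * y) / INR (S n) ^ 2) x
              (bernoulli_sum' n x + - (2 * sin (INR (S n) * x) / INR (S n)))).
    apply (@is_derive_plus R_AbsRing R_NormedModule); [exact IH |].
    set (a := INR (S n)) in *. auto_derive; [trivial |]. field. assumption.
Qed.

Lemma bernoulli_sum'_deriv (n : nat) (x : R) :
  derivable_pt_lim (bernoulli_sum' n) x (1 - dirichlet n x).
Proof.
  apply is_derive_Reals. induction n as [| n IH].
  - simpl. rewrite Rminus_diag. apply @is_derive_const.
  - assert (Hn : INR (S n) <> 0) by (apply not_0_INR; lia).
    replace (1 - dirichlet (S n) x) with ((1 - dirichlet n x) + - (2 * cos (INR (S n) * x)))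
      by (change (dirichlet (S n) x) with (dirichlet n x + 2 * cos (INR (S n) * x)); ring).
    change (is_derive (fun y => bernoulli_sum' n y + - (2 * sin (INR (S n) * y) / INR (S n))) x
              ((1 - dirichlet n x) + - (2 * cos (INR (S n) * x)))).
    apply (@is_derive_plus R_AbsRing R_NormedModule); [exact IH |].
    set (a := INR (S n)) in *. auto_derive; [trivial |]. field. assumption.
Qed.

(** The subtracted term makes the second derivative [- fejer N], which off the multiples of
    [2 PI] stays bounded while [N] grows; so second differences of the partial sums agree on
    average with those of [x^2 / 2]. *)
Definition bernoulli_cesaro (N : nat) (x : R) : R :=
  Rsum (fun n => bernoulli_sum n x) N - INR N * x ^ 2 / 2.

Definition bernoulli_cesaro' (N : nat) (x : R) : R :=
  Rsum (fun n => bernoulli_sum' n x) N - INR N * x.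

Lemma bernoulli_cesaro_deriv (N : nat) (x : R) :
  derivable_pt_lim (bernoulli_cesaro N) x (bernoulli_cesaro' N x).
Proof.
  apply is_derive_Reals. unfold bernoulli_cesaro, bernoulli_cesaro'.
  apply (@is_derive_minus R_AbsRing R_NormedModule).
  - induction N as [| N IH]; simpl; [apply @is_derive_const |].
    apply (@is_derive_plus R_AbsRing R_NormedModule); [exact IH |].
    apply is_derive_Reals, bernoulli_sum_deriv.
  - auto_derive; [trivial | field].
Qed.

Lemma bernoulli_cesaro'_deriv (N : nat) (x : R) :
  derivable_pt_lim (bernoulli_cesaro' N) x (- fejer N x).
Proof.
  apply is_derive_Reals. unfold bernoulli_cesaro'.
  replace (- fejer N x) with ((INR N - fejer N x) - INR N) by ring.
  apply (@is_derive_minus R_AbsRing R_NormedModule).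
  - induction N as [| N IH].
    + simpl. rewrite Rminus_diag. apply @is_derive_const.
    + replace (INR (S N) - fejer (S N) x) with ((INR N - fejer N x) + (1 - dirichlet N x))
        by (rewrite S_INR; simpl; ring).
      apply (@is_derive_plus R_AbsRing R_NormedModule); [exact IH |].
      apply is_derive_Reals, bernoulli_sum'_deriv.
  - auto_derive; [trivial | ring].
Qed.

Lemma second_difference_bound (f f' f'' : R -> R) (a b x h K : R) :
  (forall t, derivable_pt_lim f t (f' t)) ->
  (forall t, derivable_pt_lim f' t (f'' t)) ->
  (forall t, a <= t <= b -> Rabs (f'' t) <= K) ->
  0 < h -> a <= x -> x + 2 * h <= b ->
  Rabs (f (x + 2 * h) - 2 * f (x + h) + f x) <= h ^ 2 * K.
Proof.
  intros Hf Hf' HK Hh Ha Hb.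
  destruct (MVT_cor2 (fun t => f (t + h) - f t) (fun t => f' (t + h) - f' t) x (x + h))
    as (xi & E & Hxi); [lra | |].
  { intros c _. apply is_derive_Reals.
    apply (@is_derive_minus R_AbsRing R_NormedModule).
    - replace (f' (c + h)) with (scal 1 (f' (c + h))) by (unfold scal; simpl; unfold mult; simpl; ring).
      apply (is_derive_comp f (fun t => t + h)).
      + apply is_derive_Reals, Hf.
      + auto_derive; [trivial | ring].
    - apply is_derive_Reals, Hf. }
  destruct (MVT_cor2 f' f'' xi (xi + h)) as (ze & E' & Hze); [lra | intros; apply Hf' |].
  replace (f (x + 2 * h) - 2 * f (x + h) + f x)
    with (f (x + h + h) - f (x + h) - (f (x + h) - f x))
    by (replace (x + h + h) with (x + 2 * h) by ring; ring).
  rewrite E, E'.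
  replace (f'' ze * (xi + h - xi) * (x + h - x)) with (h ^ 2 * f'' ze) by ring.
  rewrite Rabs_mult, (Rabs_pos_eq (h ^ 2)) by nra.
  apply Rmult_le_compat_l; [nra |]. apply HK. lra.
Qed.

(** Third differences kill [x^2 / 2], so they may be computed on [bernoulli_cesaro N], whose
    second derivative [- fejer N] is bounded, uniformly in [N], on the interval
    [[x - 3 h, x]] inside [(0, 2 PI)]. *)
Lemma bernoulli_third_difference_bounded (h x : R) : 0 < h -> 3 * h < x < 2 * PI ->
  exists K, forall N,
    Rabs (Rsum (fun n => bernoulli_sum n (x - 3 * h) - 3 * bernoulli_sum n (x - 2 * h)
                         + 3 * bernoulli_sum n (x - h) - bernoulli_sum n x) N) <= K.
Proof.
  intros Hh Hx.
  destruct (cos_bounded_off_1 (x - 3 * h) x) as (eta & Heta & Hcos); try lra.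
  exists (2 * (h ^ 2 * (2 / eta))). intros N.
  assert (E : forall M, Rsum (fun n => bernoulli_sum n (x - 3 * h) - 3 * bernoulli_sum n (x - 2 * h)
                         + 3 * bernoulli_sum n (x - h) - bernoulli_sum n x) M
          = (bernoulli_cesaro M (x - 3 * h + 2 * h) - 2 * bernoulli_cesaro M (x - 3 * h + h)
             + bernoulli_cesaro M (x - 3 * h))
            - (bernoulli_cesaro M (x - 2 * h + 2 * h) - 2 * bernoulli_cesaro M (x - 2 * h + h)
             + bernoulli_cesaro M (x - 2 * h))).
  { intros M. replace (x - 3 * h + 2 * h) with (x - h) by ring.
    replace (x - 3 * h + h) with (x - 2 * h) by ring.
    replace (x - 2 * h + 2 * h) with x by ring.
    replace (x - 2 * h + h) with (x - h) by ring.
    unfold bernoulli_cesaro. induction M as [| M IH]; [simpl; field |].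
    rewrite S_INR. simpl Rsum. rewrite IH. field. }
  rewrite E. clear E.
  assert (D : forall y, x - 3 * h <= y -> y + 2 * h <= x ->
     Rabs (bernoulli_cesaro N (y + 2 * h) - 2 * bernoulli_cesaro N (y + h) + bernoulli_cesaro N y)
     <= h ^ 2 * (2 / eta)).
  { intros y Hy1 Hy2.
    apply second_difference_bound with (f' := bernoulli_cesaro' N) (f'' := fun t => - fejer N t)
      (a := x - 3 * h) (b := x); try assumption.
    - intros; apply bernoulli_cesaro_deriv.
    - intros; apply bernoulli_cesaro'_deriv.
    - intros t Ht. rewrite Rabs_Ropp, Rabs_pos_eq by apply fejer_nonneg.
      apply fejer_le_away; auto. }
  pose proof (D (x - 3 * h) ltac:(lra) ltac:(lra)) as D1.
  pose proof (D (x - 2 * h) ltac:(lra) ltac:(lra)) as D2.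
  unfold Rminus at 1. eapply Rle_trans; [apply Rabs_triang |]. rewrite Rabs_Ropp. lra.
Qed.

(** Pairing [n] with [- n - 1] enumerates [Z] with [0] occurring once. *)
Definition fold_Z (w : Z -> C) (n : nat) : C :=
  (w (Z.of_nat n) + w (- Z.of_nat n - 1)%Z)%C.

Definition summable_Z (u : Z -> C) (A : R) : Prop :=
  forall n : nat,
    Cmod (u (Z.of_nat n)) + Cmod (u (- Z.of_nat n - 1)%Z) <= A / (INR n + 1) ^ 2.

Lemma fold_summable_converges (u : Z -> C) (A B : R) (w : Z -> C) :
  summable_Z u A -> (forall l, Cmod (w l) <= B) ->
  exists s, Ctends (Csum (fold_Z (fun l => u l * w l)%C)) s /\
    forall N, Cmod (s - Csum (fold_Z (fun l => u l * w l)%C) N) <= 2 * (A * B) / (INR N + 1).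
Proof.
  intros Hu Hw.
  assert (HB : 0 <= B) by (pose proof (Hw 0%Z); pose proof (Cmod_ge_0 (w 0%Z)); lra).
  assert (Ht : forall n, Cmod (fold_Z (fun l => u l * w l)%C n) <= A * B / (INR n + 1) ^ 2).
  { intros n. unfold fold_Z. eapply Rle_trans; [apply Cmod_triangle |].
    rewrite !Cmod_mult. specialize (Hu n).
    pose proof (Hw (Z.of_nat n)). pose proof (Hw (- Z.of_nat n - 1)%Z).
    pose proof (Cmod_ge_0 (u (Z.of_nat n))). pose proof (Cmod_ge_0 (u (- Z.of_nat n - 1)%Z)).
    unfold Rdiv in *. rewrite (Rmult_comm A B), Rmult_assoc. nra. }
  destruct (inv_square_series_converges _ _ Ht) as [s Hs].
  exists s. split; [assumption |]. intros N.
  apply (Ctends_bound (fun M => Csum (fold_Z (fun l => u l * w l)%C) M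
                               + -1 * Csum (fold_Z (fun l => u l * w l)%C) N)%C _ _ N).
  - replace (s - Csum (fold_Z (fun l => u l * w l)%C) N)%C
      with (s + -1 * Csum (fold_Z (fun l => u l * w l)%C) N)%C by ring.
    apply Ctends_plus; [assumption | apply Ctends_const].
  - intros M HM.
    replace (-1 * Csum (fold_Z (fun l => u l * w l)%C) N)%C
      with (- Csum (fold_Z (fun l => u l * w l)%C) N)%C by ring.
    apply Csum_inv_square_tail; assumption.
Qed.

Definition inv_sq (l : Z) : R := if Z.eq_dec l 0 then 0 else / (IZR l) ^ 2.

Fixpoint gap_factor (h : R) (L : list Z) (l : Z) : C :=
  match L with
  | nil => 1
  | s :: L' => (expi (IZR l * - h) - expi (IZR s * - h)) * gap_factor h L' l
  end.

(** Fourier coefficients of the function obtained from [sum expi (l y) / l^2] by applying,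
    for each [s] in [L], the operator taking [Phi] to [Phi (y - h) - expi (- s h) * Phi y]. *)
Definition gap_coeff (h : R) (L : list Z) (l : Z) : C := (inv_sq l * gap_factor h L l)%C.

Lemma gap_factor_le (h : R) (L : list Z) (l : Z) : Cmod (gap_factor h L l) <= 2 ^ length L.
Proof.
  induction L as [| s L IH]; simpl.
  - rewrite Cmod_1; lra.
  - rewrite Cmod_mult. apply Rmult_le_compat; try apply Cmod_ge_0; [| assumption].
    unfold Cminus. eapply Rle_trans; [apply Cmod_triangle |].
    rewrite Cmod_opp, !Cmod_expi. lra.
Qed.

Lemma gap_factor_zero (h : R) (L : list Z) (s : Z) : In s L -> gap_factor h L s = 0.
Proof.
  induction L as [| s' L IH]; intros Hin; [destruct Hin |].
  destruct Hin as [-> | Hin]; simpl.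
  - ring.
  - rewrite IH by assumption. ring.
Qed.

(** The factor of index [s] vanishes only if [h (l - s)] is a multiple of [2 PI], which is
    impossible for small [h]. *)
Lemma gap_factor_nonzero (h : R) (L : list Z) (l : Z) :
  0 < h -> (forall s, In s L -> s <> l /\ h * Rabs (IZR l - IZR s) < 2 * PI) ->
  gap_factor h L l <> 0.
Proof.
  intros Hh. induction L as [| s L IH]; intros H; simpl.
  - intros F. apply RtoC_inj in F. lra.
  - apply Cmult_neq_0; [| apply IH; intros; apply H; right; assumption].
    destruct (H s (or_introl eq_refl)) as [Hne Hlt].
    intros F. apply Ceq_minus, expi_eq in F as [k Hk].
    assert (Hd : h * (IZR s - IZR l) = 2 * PI * IZR k) by lra.
    assert (Ha : h * Rabs (IZR l - IZR s) = 2 * PI * Rabs (IZR k)).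
    { rewrite Rabs_minus_sym, <- (Rabs_pos_eq h) at 1 by lra. rewrite <- Rabs_mult, Hd, Rabs_mult.
      f_equal. apply Rabs_pos_eq. pose proof PI_RGT_0; lra. }
    destruct (Z.eq_dec k 0) as [-> | Hk0].
    + rewrite Rabs_R0, Rmult_0_r in Ha. apply Rmult_integral in Ha as [Ha | Ha]; [lra |].
      apply Hne, eq_IZR. destruct (Req_dec (IZR l - IZR s) 0) as [E | E]; [lra |].
      apply Rabs_no_R0 in E. contradiction.
    + rewrite <- abs_IZR in Ha. assert (1 <= IZR (Z.abs k)) by (apply IZR_le; lia).
      pose proof PI_RGT_0. nra.
Qed.

Lemma inv_sq_nonneg (l : Z) : 0 <= inv_sq l.
Proof.
  unfold inv_sq. destruct (Z.eq_dec l 0) as [E | E]; [lra |].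
  apply Rlt_le, Rinv_0_lt_compat. apply pow2_gt_0, not_0_IZR, E.
Qed.

Lemma inv_sq_succ (n : nat) : inv_sq (Z.of_nat (S n)) = / INR (S n) ^ 2.
Proof.
  unfold inv_sq. destruct (Z.eq_dec _ 0) as [E | E]; [lia |].
  rewrite <- INR_IZR_INZ. reflexivity.
Qed.

Lemma inv_sq_neg (n : nat) : inv_sq (- Z.of_nat n - 1)%Z = / INR (S n) ^ 2.
Proof.
  unfold inv_sq. destruct (Z.eq_dec _ 0) as [E | E]; [lia |].
  rewrite minus_IZR, opp_IZR, <- INR_IZR_INZ, S_INR. f_equal. ring.
Qed.

Lemma inv_sq_fold_le (n : nat) :
  inv_sq (Z.of_nat n) + inv_sq (- Z.of_nat n - 1)%Z <= 5 / (INR n + 1) ^ 2.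
Proof.
  rewrite inv_sq_neg, S_INR. destruct n as [| n].
  - unfold inv_sq; simpl. lra.
  - rewrite inv_sq_succ, S_INR. set (a := INR n). assert (0 <= a) by apply pos_INR.
    assert (/ (a + 1) ^ 2 <= 4 / (a + 1 + 1) ^ 2).
    { apply Rmult_le_reg_l with ((a + 1) ^ 2 * (a + 1 + 1) ^ 2).
      - apply Rmult_lt_0_compat; apply pow_lt; lra.
      - replace ((a + 1) ^ 2 * (a + 1 + 1) ^ 2 * / (a + 1) ^ 2) with ((a + 1 + 1) ^ 2)
          by (field; lra).
        replace ((a + 1) ^ 2 * (a + 1 + 1) ^ 2 * (4 / (a + 1 + 1) ^ 2)) with (4 * (a + 1) ^ 2)
          by (field; lra). nra. }
    unfold Rdiv in *. lra.
Qed.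

Lemma gap_coeff_summable (h : R) (L : list Z) :
  summable_Z (gap_coeff h L) (2 ^ length L * 5).
Proof.
  intros n. unfold gap_coeff. rewrite !Cmod_mult, !Cmod_R.
  rewrite !Rabs_pos_eq by apply inv_sq_nonneg.
  pose proof (inv_sq_fold_le n) as A.
  pose proof (gap_factor_le h L (Z.of_nat n)) as B1.
  pose proof (gap_factor_le h L (- Z.of_nat n - 1)) as B2.
  pose proof (inv_sq_nonneg (Z.of_nat n)) as P1. pose proof (inv_sq_nonneg (- Z.of_nat n - 1)) as P2.
  assert (0 < 2 ^ length L) by (apply pow_lt; lra).
  unfold Rdiv in *. rewrite Rmult_assoc. nra.
Qed.

Lemma Csum_inv_sq_fourier (y : R) (k : nat) :
  Csum (fold_Z (fun l => inv_sq l * expi (IZR l * y))%C) (S k)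
  = (bernoulli_sum k y + RtoC (/ INR (S k) ^ 2) * expi (- (INR (S k) * y)))%C.
Proof.
  assert (Hneg : forall n : nat, IZR (- Z.of_nat n - 1) * y = - (INR (S n) * y)).
  { intros n. rewrite minus_IZR, opp_IZR, <- INR_IZR_INZ, S_INR. ring. }
  induction k as [| k IH].
  - cbn [Csum]. unfold fold_Z. rewrite inv_sq_neg, Hneg. 
    change (inv_sq (Z.of_nat 0)) with 0. change (bernoulli_sum 0 y) with 0. ring.
  - change (Csum (fold_Z (fun l => inv_sq l * expi (IZR l * y))%C) (S (S k)))
      with (Csum (fold_Z (fun l => inv_sq l * expi (IZR l * y))%C) (S k)
            + fold_Z (fun l => inv_sq l * expi (IZR l * y)) (S k))%C.
    rewrite IH. unfold fold_Z. rewrite inv_sq_neg, Hneg, inv_sq_succ, <- INR_IZR_INZ.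
    change (bernoulli_sum (S k) y) with (bernoulli_sum k y + 2 * cos (INR (S k) * y) / INR (S k) ^ 2).
    rewrite RtoC_plus. unfold Rdiv. rewrite RtoC_mult, expi_cos.
    ring.
Qed.

Lemma Ctends_inv_sq_mult_expi (y : R) :
  Ctends (fun n => RtoC (/ INR (S n) ^ 2) * expi (- (INR (S n) * y)))%C 0.
Proof.
  intros e He. destruct (inv_INR_small 1 e) as [N HN]; [lra | assumption |].
  exists N. intros n Hn. specialize (HN n Hn). unfold Cminus. rewrite Copp_0, Cplus_0_r, Cmod_mult, Cmod_expi, Cmod_R.
  rewrite S_INR. pose proof (pos_INR n).
  rewrite Rabs_pos_eq by (apply Rlt_le, Rinv_0_lt_compat, pow_lt; lra).
  rewrite Rmult_1_r. eapply Rle_trans; [| exact HN].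
  unfold Rdiv. rewrite Rmult_1_l. apply Rinv_le_contravar; nra.
Qed.

(** With [0] three times in the list the operator is the third difference.  The partial sums
    of the series converge, so their limit is also their Cesaro mean; and this mean is [0]
    because the sums of the partial sums stay bounded, up to terms tending to [0]. *)
Lemma gap_series_base (h x : R) : 0 < h -> 3 * h < x < 2 * PI ->
  Ctends (Csum (fold_Z (fun l => gap_coeff h (0 :: 0 :: 0 :: nil)%Z l * expi (IZR l * x))%C)) 0.
Proof.
  intros Hh Hx.
  destruct (fold_summable_converges _ _ 1 (fun l => expi (IZR l * x))
              (gap_coeff_summable h (0 :: 0 :: 0 :: nil)%Z)) as (s & Hs & _).
  { intros l. rewrite Cmod_expi. lra. }
  replace (RtoC 0) with s; [assumption |].
  set (T := fun y => fold_Z (fun l => inv_sq l * expi (IZR l * y))%C).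
  set (Rm := fun y n => (RtoC (/ INR (S n) ^ 2) * expi (- (INR (S n) * y)))%C).
  assert (E : forall N, Csum (fold_Z (fun l => gap_coeff h (0 :: 0 :: 0 :: nil)%Z l * expi (IZR l * x))%C) N
     = (Csum (T (x - 3 * h)%R) N + -3 * Csum (T (x - 2 * h)%R) N + 3 * Csum (T (x - h)%R) N
        + -1 * Csum (T x) N)%C).
  { intros N. rewrite <- !Csum_scal, <- !Csum_plus. apply Csum_ext. intros n _.
    assert (P : forall l, (gap_coeff h (0 :: 0 :: 0 :: nil)%Z l * expi (IZR l * x))%C
      = (inv_sq l * expi (IZR l * (x - 3 * h)) + -3 * (inv_sq l * expi (IZR l * (x - 2 * h)))
         + 3 * (inv_sq l * expi (IZR l * (x - h))) + -1 * (inv_sq l * expi (IZR l * x)))%C).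
    { intros l. unfold gap_coeff, gap_factor.
      replace (IZR l * (x - 3 * h)) with (IZR l * x + (IZR l * - h + (IZR l * - h + IZR l * - h))) by ring.
      replace (IZR l * (x - 2 * h)) with (IZR l * x + (IZR l * - h + IZR l * - h)) by ring.
      replace (IZR l * (x - h)) with (IZR l * x + IZR l * - h) by ring.
      rewrite Rmult_0_l, expi_0, !expi_add. ring. }
    unfold T, fold_Z. rewrite !P. ring. }
  apply (has_mean_unique (fun k => Csum (fold_Z
           (fun l => gap_coeff h (0 :: 0 :: 0 :: nil)%Z l * expi (IZR l * x))%C) (S k))).
  { apply has_mean_of_Ctends, (Ctends_shift _ _ Hs). }
  destruct (bernoulli_third_difference_bounded h x Hh Hx) as [K HK].
  pose proof (has_mean_0_of_bounded (fun n => RtoC (bernoulli_sum n (x - 3 * h) - 3 * bernoulli_sum n (x - 2 * h)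
                         + 3 * bernoulli_sum n (x - h) - bernoulli_sum n x)) K) as M1.
  specialize (M1 ltac:(intros N; rewrite Csum_RtoC, Cmod_R; apply HK)).
  pose proof (Ctends_plus _ _ _ _ (Ctends_plus _ _ _ _ (Ctends_plus _ _ _ _
      (Ctends_inv_sq_mult_expi (x - 3 * h)) (Ctends_scal (-3) _ _ (Ctends_inv_sq_mult_expi (x - 2 * h))))
      (Ctends_scal 3 _ _ (Ctends_inv_sq_mult_expi (x - h)))) (Ctends_scal (-1) _ _ (Ctends_inv_sq_mult_expi x))) as M2.
  apply has_mean_of_Ctends in M2.
  pose proof (has_mean_plus _ _ _ _ M1 M2) as M3.
  replace (RtoC 0) with (0 + (0 + -3 * 0 + 3 * 0 + -1 * 0))%C by ring.
  eapply has_mean_ext; [| exact M3]. intros k. cbv beta.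
  rewrite E. unfold T. rewrite !Csum_inv_sq_fourier.
  rewrite !RtoC_minus, !RtoC_plus, RtoC_minus, !RtoC_mult. ring.
Qed.

(** Each further operator combines the values at [y - h] and [y], so it shortens the interval
    on which the series vanishes by [h]. *)
Lemma gap_series_vanishes (h x : R) (L : list Z) :
  0 < h -> (3 + INR (length L)) * h < x < 2 * PI ->
  Ctends (Csum (fold_Z
    (fun l => gap_coeff h (L ++ 0 :: 0 :: 0 :: nil)%Z l * expi (IZR l * x))%C)) 0.
Proof.
  intros Hh. revert x. induction L as [| s L IH]; intros x Hx.
  - simpl in Hx. apply gap_series_base; lra.
  - change (length (s :: L)) with (S (length L)) in Hx. rewrite S_INR in Hx.
    pose proof (Ctends_plus _ _ _ _ (IH (x - h) ltac:(lra))
      (Ctends_scal (- expi (IZR s * - h))%C _ _ (IH x ltac:(lra)))) as A.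
    replace (RtoC 0) with (0 + (- expi (IZR s * - h)) * 0)%C by ring.
    eapply Ctends_ext; [| exact A]. intros N. cbv beta.
    rewrite <- Csum_scal, <- Csum_plus. apply Csum_ext. intros n _.
    assert (P : forall l, (gap_coeff h ((s :: L) ++ 0 :: 0 :: 0 :: nil)%Z l * expi (IZR l * x))%C
      = (gap_coeff h (L ++ 0 :: 0 :: 0 :: nil)%Z l * expi (IZR l * (x - h))
         + - expi (IZR s * - h) * (gap_coeff h (L ++ 0 :: 0 :: 0 :: nil)%Z l * expi (IZR l * x)))%C).
    { intros l. unfold gap_coeff. cbn [gap_factor app].
      replace (IZR l * (x - h)) with (IZR l * x + IZR l * - h) by ring.
      rewrite expi_add. ring. }
    unfold fold_Z. rewrite !P. ring.
Qed.

Lemma Zlist_bounded (L : list Z) : exists K, 0 < K /\ forall s, In s L -> Rabs (1 - IZR s) <= K.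
Proof.
  induction L as [| s L (K & HK & IH)].
  - exists 1. split; [lra |]. intros s Hs; destruct Hs.
  - exists (K + Rabs (1 - IZR s)). pose proof (Rabs_pos (1 - IZR s)). split; [lra |].
    intros s' [<- | Hs]; [lra |]. specialize (IH s' Hs). lra.
Qed.

(** The prescribed zeros [S] and the arc [(a, b)] determine the list and the step of
    [gap_coeff]; multiplying by [expi (- l a0)] rotates the gap to the complement of the arc. *)
Lemma gap_weights_exist (S : list Z) (a b : R) : a < b ->
  exists (u : Z -> C) (A : R),
    summable_Z u A /\ u 1%Z <> 0 /\
    (forall s, In s S -> s <> 1%Z -> u s = 0) /\
    forall y, (forall k : Z, ~ a < y + 2 * PI * IZR k < b) ->
      Ctends (Csum (fold_Z (fun l => u l * expi (IZR l * y))%C)) 0.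
Proof.
  intros Hab. pose proof PI_RGT_0 as HPI.
  set (L := filter (fun s => negb (Z.eqb s 1)) S).
  set (L' := (L ++ 0 :: 0 :: 0 :: nil)%Z).
  assert (HL : forall s, In s L -> s <> 1%Z).
  { intros s Hs. apply filter_In in Hs as [_ Hs]. intros ->. discriminate. }
  assert (HL' : forall s, In s L' -> s <> 1%Z).
  { intros s Hs. apply in_app_or in Hs as [Hs | Hs]; [auto |].
    simpl in Hs. intuition lia. }
  destruct (Zlist_bounded L') as (K & HK & HKL).
  set (D := 3 + INR (length L) + K).
  assert (HD : 3 <= D) by (pose proof (pos_INR (length L)); unfold D; lra).
  (* [m / 2] bounds both the length [(3 + |L|) h] of the interval on which the series need
     not vanish, and [h |1 - s|] for all [s] in the list. *)
  set (m := Rmin ((b - a) / 2) (2 * PI)).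
  assert (Hm : 0 < m) by (apply Rmin_glb_lt; lra).
  set (h := m / (2 * D)).
  assert (Hh : 0 < h) by (apply Rdiv_lt_0_compat; lra).
  assert (HhD : h * D = m / 2) by (unfold h; field; lra).
  assert (Hm1 : m <= (b - a) / 2) by apply Rmin_l.
  assert (Hm2 : m <= 2 * PI) by apply Rmin_r.
  set (a0 := (a + b) / 2).
  exists (fun l => gap_coeff h L' l * expi (IZR l * - a0))%C, (2 ^ length L' * 5).
  split; [| split; [| split]].
  - intros n. rewrite !Cmod_mult, !Cmod_expi, !Rmult_1_r. apply gap_coeff_summable.
  - apply Cmult_neq_0; [| apply expi_neq_0].
    unfold gap_coeff. apply Cmult_neq_0.
    + unfold inv_sq. simpl. intros F. apply RtoC_inj in F. lra.
    + apply gap_factor_nonzero; [assumption |]. intros s Hs. split; [auto |].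
      specialize (HKL s Hs). pose proof (pos_INR (length L)).
      apply Rle_lt_trans with (h * D); [apply Rmult_le_compat_l; unfold D; lra | lra].
  - intros s Hs Hne. unfold gap_coeff. rewrite gap_factor_zero; [ring |].
    apply in_or_app. left. apply filter_In. split; [assumption |].
    apply Bool.negb_true_iff, Z.eqb_neq, Hne.
  - intros y Hy. destruct (reduce_mod_2PI (y - a0)) as [k Hk].
    assert (Hgt : m / 2 < y - a0 + 2 * PI * IZR k).
    { apply Rnot_le_lt. intros F. apply (Hy k). unfold a0 in *. lra. }
    assert (V := gap_series_vanishes h (y - a0 + 2 * PI * IZR k) L Hh).
    eapply Ctends_ext; [| apply V].
    + intros N. apply Csum_ext. intros n _.
      assert (P : forall l, (gap_coeff h L' l * expi (IZR l * (y - a0 + 2 * PI * IZR k)))%C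
                  = (gap_coeff h L' l * expi (IZR l * - a0) * expi (IZR l * y))%C).
      { intros l. replace (IZR l * (y - a0 + 2 * PI * IZR k))
          with (IZR l * - a0 + IZR l * y + 2 * PI * IZR (l * k)) by (rewrite mult_IZR; ring).
        rewrite expi_period, expi_add. ring. }
      unfold fold_Z. fold L'. rewrite !P. reflexivity.
    + split; [| lra]. apply Rle_lt_trans with (h * D); [| lra].
      rewrite Rmult_comm. apply Rmult_le_compat_l; unfold D; lra.
Qed.

(** * A jump forces a nonzero mean with frequency in the arc *)

Lemma injective_finite_preimage (e : Z -> C) (l : list C) :
  (forall i j, e i = e j -> i = j) -> exists S, forall i, In (e i) l -> In i S.
Proof.
  intros He. induction l as [| d l [S IH]].
  - exists nil. intros i Hi. destruct Hi.
  - destruct (classic (exists i, e i = d)) as [[i0 H0] | H0].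
    + exists (i0 :: S). intros i [Hi | Hi].
      * left. apply He. congruence.
      * right. auto.
    + exists S. intros i [Hi | Hi]; [| auto]. elim H0. exists i. congruence.
Qed.

Lemma Csum_fold_Z_drop_1 (w : Z -> C) (N : nat) :
  Csum (fold_Z w) (2 + N)
  = (Csum (fold_Z (fun l => if Z.eq_dec l 1 then 0 else w l)) (2 + N) + w 1%Z)%C.
Proof.
  rewrite !Csum_add.
  rewrite (Csum_ext (fun n => fold_Z (fun l => if Z.eq_dec l 1 then RtoC 0 else w l) (2 + n))
             (fun n => fold_Z w (2 + n))).
  - cbn [Csum]. unfold fold_Z. simpl. ring.
  - intros n _. unfold fold_Z.
    destruct (Z.eq_dec (Z.of_nat (2 + n)) 1); [lia |].
    destruct (Z.eq_dec (- Z.of_nat (2 + n) - 1) 1); [lia | reflexivity].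
Qed.

Lemma cont_at_plus (G H : R -> C) (t : R) :
  cont_at G t -> cont_at H t -> cont_at (fun x => G x + H x)%C t.
Proof.
  intros HG HH e He.
  destruct (HG (e / 2)) as (d1 & P1 & Q1); [lra |].
  destruct (HH (e / 2)) as (d2 & P2 & Q2); [lra |].
  exists (Rmin d1 d2). split; [apply Rmin_glb_lt; assumption |]. intros y Hy.
  pose proof (Rmin_l d1 d2). pose proof (Rmin_r d1 d2).
  specialize (Q1 y ltac:(lra)). specialize (Q2 y ltac:(lra)).
  replace (G y + H y - (G t + H t))%C with ((G y - G t) + (H y - H t))%C by ring.
  eapply Rle_trans; [apply Cmod_triangle | lra].
Qed.

Lemma cont_at_scal (a : C) (G : R -> C) (t : R) :
  a = 0 \/ cont_at G t -> cont_at (fun x => a * G x)%C t.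
Proof.
  intros [-> | HG] e He.
  - exists 1. split; [lra |]. intros y _.
    replace (0 * G y - 0 * G t)%C with (RtoC 0) by ring. rewrite Cmod_0; lra.
  - pose proof (Cmod_ge_0 a).
    destruct (HG (e / (Cmod a + 1))) as (d & Hd & Hy); [apply Rdiv_lt_0_compat; lra |].
    exists d. split; [assumption |]. intros y H1. specialize (Hy y H1).
    replace (a * G y - a * G t)%C with (a * (G y - G t))%C by ring. rewrite Cmod_mult.
    apply Rle_trans with ((Cmod a + 1) * (e / (Cmod a + 1))).
    + apply Rmult_le_compat; try lra; apply Cmod_ge_0.
    + right; field; lra.
Qed.

Lemma cont_at_mult_expi (G : R -> C) (a t : R) :
  cont_at G t -> cont_at (fun x => G x * expi (a * x))%C t.
Proof.
  intros HG e He. destruct (HG (e / 2)) as (d1 & Hd1 & H1); [lra |].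
  set (K := Cmod (G t) * Rabs a + 1).
  assert (HK : 0 < K).
  { pose proof (Cmod_ge_0 (G t)). pose proof (Rabs_pos a). unfold K. nra. }
  exists (Rmin d1 (e / 2 / K)). split.
  { apply Rmin_glb_lt; [assumption |]. repeat apply Rdiv_lt_0_compat; lra. }
  intros y Hy. pose proof (Rmin_l d1 (e / 2 / K)). pose proof (Rmin_r d1 (e / 2 / K)).
  specialize (H1 y ltac:(lra)).
  replace (G y * expi (a * y) - G t * expi (a * t))%C
    with ((G y - G t) * expi (a * y) + G t * (expi (a * y) - expi (a * t)))%C by ring.
  eapply Rle_trans; [apply Cmod_triangle |]. rewrite !Cmod_mult, Cmod_expi, Rmult_1_r.
  pose proof (Cmod_expi_minus_le (a * y) (a * t)) as E.
  rewrite <- Rmult_minus_distr_l, Rabs_mult in E.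
  assert (T : Cmod (G t) * Cmod (expi (a * y) - expi (a * t)) <= K * Rabs (y - t)).
  { apply Rle_trans with (Cmod (G t) * (Rabs a * Rabs (y - t))).
    - apply Rmult_le_compat_l; [apply Cmod_ge_0 | assumption].
    - rewrite <- Rmult_assoc. apply Rmult_le_compat_r; [apply Rabs_pos | unfold K; lra]. }
  assert (K * Rabs (y - t) <= K * (e / 2 / K)) by (apply Rmult_le_compat_l; lra).
  replace (K * (e / 2 / K)) with (e / 2) in * by (field; lra). lra.
Qed.

Lemma cont_at_Csum (v : R -> nat -> C) (t : R) (N : nat) :
  (forall n, cont_at (fun x => v x n) t) -> cont_at (fun x => Csum (v x) N) t.
Proof.
  intros H. induction N as [| N IH]; simpl.
  - intros e He. exists 1. split; [lra |]. intros y _.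
    replace (0 - 0)%C with (RtoC 0) by ring. rewrite Cmod_0; lra.
  - apply cont_at_plus; auto.
Qed.

Lemma cont_at_uniform_limit (P : nat -> R -> C) (G : R -> C) (t K : R) :
  (forall N, cont_at (P N) t) ->
  (forall x N, Cmod (G x - P N x) <= K / (INR N + 1)) -> cont_at G t.
Proof.
  intros HP HG e He.
  assert (HK : 0 <= K).
  { specialize (HG 0 O). simpl in HG. pose proof (Cmod_ge_0 (G 0 - P O 0)%C). lra. }
  destruct (inv_INR_small K (e / 3) HK) as [N HN]; [lra |]. specialize (HN N (le_n N)).
  destruct (HP N (e / 3)) as (d & Hd & Hy); [lra |].
  exists d. split; [assumption |]. intros y H1. specialize (Hy y H1).
  pose proof (HG y N) as G1. pose proof (HG t N) as G2. rewrite Cmod_minus_sym in G2.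
  pose proof (Cmod_triangle_sub (G y) (P N y) (G t)).
  pose proof (Cmod_triangle_sub (P N y) (P N t) (G t)). lra.
Qed.

(** The shift by [1] puts the unshifted value [F x] at index [1], because index [0] is killed
    by the third difference in [gap_coeff]. *)
Definition orbit_terms (u : Z -> C) (F : R -> C) (tau x : R) : nat -> C :=
  fold_Z (fun l => u l * F (x - tau * IZR (l - 1))%R)%C.

Lemma orbit_sum_exists (u : Z -> C) (A B tau : R) (F : R -> C) :
  summable_Z u A -> (forall x, Cmod (F x) <= B) ->
  exists G : R -> C, forall x,
    Ctends (Csum (orbit_terms u F tau x)) (G x) /\
    forall N, Cmod (G x - Csum (orbit_terms u F tau x) N) <= 2 * (A * B) / (INR N + 1).
Proof.
  intros Hu HF.
  apply (functional_choice (fun x g => Ctends (Csum (orbit_terms u F tau x)) g /\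
    forall N, Cmod (g - Csum (orbit_terms u F tau x) N) <= 2 * (A * B) / (INR N + 1))).
  intros x. apply (fold_summable_converges u A B (fun l => F (x - tau * IZR (l - 1)))); auto.
Qed.

(** Translating the orbit by [k] steps does not change means, so the term of index [l] has
    mean [c * u l * expi (tau j (l - 1))].  Summing over [l] gives [c] times the Fourier series
    of [u] at [tau j], and one of the two factors is [0]. *)
Lemma orbit_sum_mean (x0 tau A B : R) (u : Z -> C) (F G : R -> C) (j : Z) (c : C) :
  (forall x, Cmod (F x) <= B) ->
  fourier_mean x0 tau F j c ->
  (forall x N, Cmod (G x - Csum (orbit_terms u F tau x) (2 + N)) <= A / (INR N + 1)) ->
  c = 0 \/ Ctends (Csum (fold_Z (fun l => u l * expi (IZR l * (tau * IZR j)))%C)) 0 ->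
  fourier_mean x0 tau G j 0.
Proof.
  intros HB Hc HG Hz.
  assert (HA : 0 <= A).
  { specialize (HG 0 O). simpl INR in HG.
    pose proof (Cmod_ge_0 (G 0 - Csum (orbit_terms u F tau 0) (2 + 0))%C). lra. }
  assert (Hl : forall l : Z, has_mean
      (fun n => u l * F (x0 + INR n * tau - tau * IZR (l - 1))%R * expi (IZR j * (x0 + INR n * tau)))%C
      (expi (- (tau * IZR j)) * c * (u l * expi (IZR l * (tau * IZR j))))%C).
  { intros l.
    pose proof (orbit_mean_translate x0 tau B (fun x => F x * expi (IZR j * x))%C c (l - 1)) as T.
    specialize (T ltac:(intros x; cbv beta; rewrite Cmod_mult, Cmod_expi, Rmult_1_r; apply HB) Hc).
    pose proof (has_mean_scal (u l * expi (tau * IZR j * IZR (l - 1))) _ _ T) as T'.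
    replace (expi (- (tau * IZR j)) * c * (u l * expi (IZR l * (tau * IZR j))))%C
      with (u l * expi (tau * IZR j * IZR (l - 1)) * c)%C.
    - eapply has_mean_ext; [| exact T']. intros n. cbv beta.
      replace (IZR j * (x0 + INR n * tau))
        with (tau * IZR j * IZR (l - 1) + IZR j * (x0 + INR n * tau - tau * IZR (l - 1))) by ring.
      rewrite (expi_add (tau * IZR j * IZR (l - 1))). ring.
    - rewrite minus_IZR.
      replace (tau * IZR j * (IZR l - 1)) with (- (tau * IZR j) + IZR l * (tau * IZR j)) by ring.
      rewrite expi_add. ring. }
  apply has_mean_of_approx. intros e He.
  destruct (inv_INR_small A e HA He) as [N1 HN1].
  assert (HN2 : exists N2, forall N, (N2 <= N)%nat ->
     Cmod (Csum (fold_Z (fun l => expi (- (tau * IZR j)) * c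
              * (u l * expi (IZR l * (tau * IZR j))))%C) N - 0) <= e).
  { assert (X : Ctends (Csum (fold_Z (fun l => expi (- (tau * IZR j)) * c
              * (u l * expi (IZR l * (tau * IZR j))))%C)) 0).
    { destruct Hz as [-> | Hz].
      - eapply Ctends_ext with (u := fun _ => RtoC 0).
        + intros n. rewrite (Csum_ext _ (fun _ => 0 * 0)%C).
          * rewrite Csum_scal. ring.
          * intros k _. unfold fold_Z. ring.
        + apply Ctends_const.
      - pose proof (Ctends_scal (expi (- (tau * IZR j)) * c) _ _ Hz) as X.
        rewrite Cmult_0_r in X. eapply Ctends_ext; [| exact X]. intros n. cbv beta.
        rewrite <- Csum_scal. apply Csum_ext. intros k _. unfold fold_Z. ring. }
    exact (X e He). }
  destruct HN2 as [N2 HN2]. set (N := (N1 + N2)%nat).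
  specialize (HN1 N ltac:(lia)). specialize (HN2 (2 + N)%nat ltac:(lia)).
  eexists _, _. split; [| split; [| exact HN2]].
  - apply has_mean_Csum with (v := fun i n => (orbit_terms u F tau (x0 + INR n * tau) i
                                    * expi (IZR j * (x0 + INR n * tau)))%C).
    intros i. unfold orbit_terms, fold_Z.
    eapply has_mean_ext; [| exact (has_mean_plus _ _ _ _ (Hl (Z.of_nat i)) (Hl (- Z.of_nat i - 1)%Z))].
    intros n. cbv beta. ring.
  - intros n. cbv beta. set (x := x0 + INR n * tau).
    rewrite (Csum_ext _ (fun i => expi (IZR j * x) * orbit_terms u F tau x i)%C)
      by (intros; ring).
    rewrite Csum_scal.
    replace (G x * expi (IZR j * x) - expi (IZR j * x) * Csum (orbit_terms u F tau x) (2 + N))%C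
      with (expi (IZR j * x) * (G x - Csum (orbit_terms u F tau x) (2 + N)))%C by ring.
    rewrite Cmod_mult, Cmod_expi, Rmult_1_l. eapply Rle_trans; [apply HG | assumption].
Qed.

(** If all means with frequency in the arc were [0], the function
    [H x = sum u l * F (x - tau (l - 1))] would be orthogonal to all characters, so both its
    one-sided limits at [t] would be [0]; but they differ by [u 1 * (l2 - l1)]. *)
Lemma jump_gives_resonance (x0 tau : R)
  (hirr : irrational_rotation tau)
  (F : R -> C) (B : R) (lst : list C) (t : R) (l1 l2 : C) (a b : R) :
  (forall x, Cmod (F x) <= B) ->
  periodic_2PI F ->
  continuous_off lst F ->
  (forall eps, 0 < eps -> exists delta, 0 < delta /\
     forall x, t - delta < x < t -> Cmod (F x - l1) <= eps) ->
  (forall eps, 0 < eps -> exists delta, 0 < delta /\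
     forall x, t < x < t + delta -> Cmod (F x - l2) <= eps) ->
  l1 <> l2 -> a < b ->
  exists (j k : Z) (c : C), a < tau * IZR j + 2 * PI * IZR k < b /\ c <> 0 /\
    fourier_mean x0 tau F j c.
Proof.
  intros HB Hper Hcont Hl1 Hl2 Hne Hab. apply NNPP. intros Hno. apply Hne.
  destruct (injective_finite_preimage (fun l => expi (t - tau * IZR (l - 1))) lst) as [S HS].
  { intros i j E. apply expi_eq in E as [k Hk]. rewrite !minus_IZR in Hk.
    assert (Z0 : (j - i = 0)%Z); [| lia].
    apply hirr. rewrite minus_IZR.
    replace (tau * (IZR j - IZR i)) with (0 + 2 * PI * IZR k) by lra.
    rewrite expi_period. apply expi_0. }
  destruct (gap_weights_exist S a b Hab) as (u & A & Hu & Hu1 & HuS & Hvan).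
  (* [G] collects the terms of [H] other than the one of index [1]; it is continuous at
     [t], so the whole jump of [H] comes from [u 1 * F]. *)
  set (u' := fun l => if Z.eq_dec l 1 then RtoC 0 else u l).
  assert (Hu' : summable_Z u' A).
  { intros n. eapply Rle_trans; [| apply (Hu n)]. unfold u'.
    apply Rplus_le_compat; destruct (Z.eq_dec _ 1); rewrite ?Cmod_0; try apply Cmod_ge_0; lra. }
  destruct (orbit_sum_exists u' A B tau F Hu' HB) as [G HG].
  assert (HB0 : 0 <= B) by (pose proof (HB 0); pose proof (Cmod_ge_0 (F 0)); lra).
  assert (HA0 : 0 <= A).
  { pose proof (Hu O) as H0. simpl in H0. pose proof (Cmod_ge_0 (u 0%Z)).
    pose proof (Cmod_ge_0 (u (-1)%Z)). lra. }
  assert (HGt : cont_at G t).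
  { apply cont_at_uniform_limit with (P := fun N x => Csum (orbit_terms u' F tau x) N)
      (K := 2 * (A * B)).
    - intros N. apply cont_at_Csum. intros n. unfold orbit_terms, fold_Z.
      assert (Hc : forall l, cont_at (fun x => u' l * F (x - tau * IZR (l - 1))%R)%C t).
      { intros l. apply (cont_at_scal (u' l) (fun x => F (x - tau * IZR (l - 1)))). unfold u'.
        destruct (Z.eq_dec l 1) as [El | El]; [left; reflexivity |].
        destruct (classic (In (expi (t - tau * IZR (l - 1))) lst)) as [Hin | Hin].
        - left. apply HuS; auto.
        - right. intros e He. destruct (Hcont _ Hin e He) as (d & Hd & Hy).
          exists d. split; [assumption |]. intros y Hyt. apply Hy.
          replace (y - tau * IZR (l - 1) - (t - tau * IZR (l - 1))) with (y - t) by ring.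
          assumption. }
      apply cont_at_plus; apply Hc.
    - intros x N. apply HG. }
  set (H := fun x => (G x + u 1%Z * F x)%C).
  assert (HGper : forall x (k : Z), G (x + 2 * PI * IZR k) = G x).
  { intros x k. apply (Ctends_unique (Csum (orbit_terms u' F tau x))); [| apply HG].
    eapply Ctends_ext; [| apply HG]. intros N. apply Csum_ext. intros n _.
    assert (P : forall y, F (x + 2 * PI * IZR k - y) = F (x - y)).
    { intros y. rewrite <- (Hper (x - y) k). f_equal. ring. }
    unfold orbit_terms, fold_Z. rewrite !P. reflexivity. }
  assert (HHper : forall x (k : Z), H (x + 2 * PI * IZR k) = H x).
  { intros x k. unfold H. rewrite HGper, Hper. reflexivity. }
  assert (HHB : forall x, Cmod (H x) <= 2 * (A * B) + Cmod (u 1%Z) * B).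
  { intros x. unfold H. eapply Rle_trans; [apply Cmod_triangle |].
    destruct (HG x) as [_ T]. specialize (T O). simpl in T.
    unfold Cminus in T. rewrite Copp_0, Cplus_0_r in T.
    rewrite Cmod_mult. specialize (HB x). pose proof (Cmod_ge_0 (u 1%Z)).
    replace (2 * (A * B) / (0 + 1)) with (2 * (A * B)) in T by field. nra. }
  assert (HHterms : forall x N,
     Cmod (H x - Csum (orbit_terms u F tau x) (2 + N)) <= 2 * (A * B) / (INR N + 1)).
  { intros x N. unfold orbit_terms at 1. rewrite Csum_fold_Z_drop_1.
    destruct (HG x) as [_ T]. specialize (T (2 + N)%nat).
    replace (H x - _)%C with (G x - Csum (orbit_terms u' F tau x) (2 + N))%C.
    - eapply Rle_trans; [exact T |]. pose proof (pos_INR N).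
      apply Rmult_le_compat_l; [nra |]. apply Rinv_le_contravar; [lra |].
      rewrite plus_INR. simpl. lra.
    - unfold H, orbit_terms.
      replace (x - tau * IZR (1 - 1)) with x by (simpl; ring).
      rewrite (Csum_ext (fold_Z (fun l => if Z.eq_dec l 1 then _ else _))
                 (fold_Z (fun l => u' l * F (x - tau * IZR (l - 1))%R)%C)).
      + ring.
      + intros n _. unfold fold_Z, u'.
        destruct (Z.eq_dec (Z.of_nat n) 1); destruct (Z.eq_dec (- Z.of_nat n - 1) 1); ring. }
  assert (HHm : forall j : Z,
     fourier_mean x0 tau H j 0).
  { intros j.
    destruct (orbit_mean_exists x0 tau hirr (fun x => F x * expi (IZR j * x))%C B lst) as [c Hc].
    - intros x. rewrite Cmod_mult, Cmod_expi, Rmult_1_r. apply HB.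
    - intros x k. cbv beta. rewrite Hper. f_equal.
      replace (IZR j * (x + 2 * PI * IZR k)) with (IZR j * x + 2 * PI * IZR (j * k))
        by (rewrite mult_IZR; ring).
      apply expi_period.
    - intros x Hx. apply cont_at_mult_expi, Hcont, Hx.
    - apply (orbit_sum_mean x0 tau (2 * (A * B)) B u F H j c HB Hc HHterms).
      destruct (classic (exists k : Z, a < tau * IZR j + 2 * PI * IZR k < b)) as [[k Hk] | Hk].
      + left. apply NNPP. intros Hc0. apply Hno. exists j, k, c. auto.
      + right. apply Hvan. intros k Hk'. apply Hk. exists k. exact Hk'. }
  (* [s] selects the side; the interval of centre [t + s d / 2] and radius [d / 2] lies on
     that side of [t]. *)
  assert (Hside : forall s (l : C), s = 1 \/ s = -1 ->
     (forall eps, 0 < eps -> exists delta, 0 < delta /\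
        forall x, 0 < s * (x - t) < delta -> Cmod (F x - l) <= eps) ->
     (G t + u 1%Z * l)%C = 0).
  { intros s l Hs Hl.
    apply (one_sided_limit_zero x0 tau hirr H _ _ HHB HHper HHm). intros e He.
    pose proof (Cmod_ge_0 (u 1%Z)) as Hu0.
    destruct (Hl (e / 2 / (Cmod (u 1%Z) + 1))) as (d1 & Hd1 & H1);
      [repeat apply Rdiv_lt_0_compat; lra |].
    destruct (HGt (e / 2)) as (d2 & Hd2 & H2); [lra |].
    set (d := Rmin d1 d2). assert (Hd : 0 < d) by (apply Rmin_glb_lt; assumption).
    assert (d <= d1) by apply Rmin_l. assert (d <= d2) by apply Rmin_r.
    exists (t + s * (d / 2)), (d / 2). split; [lra |]. intros x Hx.
    apply Rabs_def2 in Hx.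
    specialize (H1 x ltac:(destruct Hs as [-> | ->]; lra)).
    specialize (H2 x ltac:(apply Rabs_def1; destruct Hs as [-> | ->]; lra)).
    unfold H. replace (G x + u 1%Z * F x - (G t + u 1%Z * l))%C
      with ((G x - G t) + u 1%Z * (F x - l))%C by ring.
    eapply Rle_trans; [apply Cmod_triangle |]. rewrite Cmod_mult.
    assert (Cmod (u 1%Z) * Cmod (F x - l) <= e / 2); [| lra].
    replace (e / 2) with ((Cmod (u 1%Z) + 1) * (e / 2 / (Cmod (u 1%Z) + 1))) by (field; lra).
    apply Rmult_le_compat; try apply Cmod_ge_0; lra. }
  assert (E1 : (G t + u 1%Z * l1)%C = 0).
  { apply (Hside (-1)); [right; reflexivity |]. intros e He.
    destruct (Hl1 e He) as (d & Hd & Hx). exists d. split; [assumption |].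
    intros x Hxt. apply Hx. lra. }
  assert (E2 : (G t + u 1%Z * l2)%C = 0).
  { apply (Hside 1); [left; reflexivity |]. intros e He.
    destruct (Hl2 e He) as (d & Hd & Hx). exists d. split; [assumption |].
    intros x Hxt. apply Hx. lra. }
  replace l1 with (/ u 1%Z * ((G t + u 1%Z * l1) - G t))%C by (field; assumption).
  replace l2 with (/ u 1%Z * ((G t + u 1%Z * l2) - G t))%C by (field; assumption).
  rewrite E1, E2. reflexivity.
Qed.

(** * Power series with bounded coefficients *)

Definition disk_sum (a : nat -> C) (g : C -> C) : Prop :=
  forall z, Cmod z < 1 -> Ctends (Csum (fun n => a n * z ^ n)%C) (g z).

Lemma geometric_partial_sum_le (r : R) (N M : nat) : 0 <= r < 1 ->
  Rsum (fun n => r ^ (N + n)) M <= r ^ N / (1 - r).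
Proof.
  intros Hr.
  assert (A : (1 - r) * Rsum (fun n => r ^ (N + n)) M = r ^ N - r ^ (N + M)).
  { induction M as [| M IH].
    - simpl. rewrite Nat.add_0_r. ring.
    - rewrite Nat.add_succ_r. simpl. rewrite Rmult_plus_distr_l, IH. ring. }
  apply Rmult_le_reg_l with (1 - r); [lra |]. rewrite A.
  replace ((1 - r) * (r ^ N / (1 - r))) with (r ^ N) by (field; lra).
  pose proof (pow_le r (N + M) (proj1 Hr)). lra.
Qed.

Lemma pow_small (r K eps : R) : 0 <= r < 1 -> 0 <= K -> 0 < eps ->
  exists N, forall n, (N <= n)%nat -> K * r ^ n <= eps.
Proof.
  intros Hr HK He.
  destruct (pow_lt_1_zero r) with (y := eps / (K + 1)) as [N HN].
  - rewrite Rabs_pos_eq; lra.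
  - apply Rdiv_lt_0_compat; lra.
  - exists N. intros n Hn. specialize (HN n Hn).
    pose proof (pow_le r n (proj1 Hr)). rewrite Rabs_pos_eq in HN by assumption.
    apply Rle_trans with ((K + 1) * (eps / (K + 1))).
    + apply Rmult_le_compat; lra.
    + right; field; lra.
Qed.

Lemma geometric_series_converges (t : nat -> C) (B r : R) :
  0 <= r < 1 -> (forall n, Cmod (t n) <= B * r ^ n) ->
  exists l, Ctends (Csum t) l /\ Cmod l <= B / (1 - r).
Proof.
  intros Hr Ht.
  assert (HB : 0 <= B).
  { specialize (Ht O). simpl in Ht. pose proof (Cmod_ge_0 (t O)). lra. }
  assert (T : forall N M, Cmod (Csum (fun n => t (N + n)%nat) M) <= B * (r ^ N / (1 - r))).
  { intros N M. eapply Rle_trans.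
    - apply Csum_Cmod_le with (v := fun n => B * r ^ (N + n)). intros n _. apply Ht.
    - rewrite Rsum_scal. apply Rmult_le_compat_l; [assumption | apply geometric_partial_sum_le, Hr]. }
  assert (Hc : exists l, Ctends (Csum t) l).
  { apply Ctends_cauchy. intros e He.
    destruct (pow_small r (B / (1 - r)) e Hr) as [N HN]; [| assumption |].
    { apply Rmult_le_pos; [assumption | apply Rlt_le, Rinv_0_lt_compat; lra]. }
    exists N.
    assert (Le : forall n m, (N <= n)%nat -> (n <= m)%nat -> Cmod (Csum t m - Csum t n) <= e).
    { intros n m Hn Hm. replace m with (n + (m - n))%nat by lia. rewrite Csum_add.
      replace (Csum t n + Csum (fun k => t (n + k)%nat) (m - n) - Csum t n)%C
        with (Csum (fun k => t (n + k)%nat) (m - n)) by ring.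
      eapply Rle_trans; [apply T |]. eapply Rle_trans; [| apply (HN n Hn)].
      right. field. lra. }
    intros n m Hn Hm. destruct (Nat.le_gt_cases n m).
    - rewrite Cmod_minus_sym. apply Le; assumption.
    - apply Le; [assumption | lia]. }
  destruct Hc as [l Hl]. exists l. split; [assumption |].
  apply (Ctends_bound _ _ _ 0%nat Hl). intros n _.
  specialize (T O n). simpl in T. replace (B / (1 - r)) with (B * (1 / (1 - r))) by (field; lra).
  exact T.
Qed.

Lemma power_series_value (a : nat -> C) (B : R) (z : C) :
  (forall n, Cmod (a n) <= B) -> Cmod z < 1 ->
  exists l, Ctends (Csum (fun n => a n * z ^ n)%C) l /\ Cmod l <= B / (1 - Cmod z).
Proof.
  intros Ha Hz. apply geometric_series_converges.
  - split; [apply Cmod_ge_0 | assumption].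
  - intros n. rewrite Cmod_mult, Cmod_pow. apply Rmult_le_compat_r; [| apply Ha].
    apply pow_le, Cmod_ge_0.
Qed.

Lemma disk_sum_exists (a : nat -> C) (B : R) :
  (forall n, Cmod (a n) <= B) -> exists g, disk_sum a g.
Proof.
  intros Ha.
  assert (H : forall z, exists l, Cmod z < 1 -> Ctends (Csum (fun n => a n * z ^ n)%C) l).
  { intros z. destruct (Rlt_dec (Cmod z) 1) as [Hz | Hz].
    - destruct (power_series_value a B z Ha Hz) as (l & Hl & _). exists l. auto.
    - exists 0. contradiction. }
  destruct (functional_choice _ H) as [g Hg]. exists g. exact Hg.
Qed.

Lemma disk_sum_bound (a : nat -> C) (B : R) (g : C -> C) (z : C) :
  (forall n, Cmod (a n) <= B) -> disk_sum a g -> Cmod z < 1 ->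
  Cmod (g z) <= B / (1 - Cmod z).
Proof.
  intros Ha Hg Hz. destruct (power_series_value a B z Ha Hz) as (l & Hl & Hb).
  rewrite (Ctends_unique _ _ _ (Hg z Hz) Hl). assumption.
Qed.

(** The difference quotient of a power series at [z] is again a power series with bounded
    coefficients, [b k = sum_n a (k + 1 + n) z^n].  Applied twice, this gives both a Lipschitz
    bound and complex differentiability without differentiating term by term. *)
Lemma disk_sum_quotient (a : nat -> C) (B : R) (g : C -> C) (z : C) :
  (forall n, Cmod (a n) <= B) -> disk_sum a g -> Cmod z < 1 ->
  exists (b : nat -> C) (Q : C -> C),
    (forall n, Cmod (b n) <= B / (1 - Cmod z)) /\ disk_sum b Q /\
    forall w, Cmod w < 1 -> (g w - g z)%C = ((w - z) * Q w)%C.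
Proof.
  intros Ha Hg Hz.
  assert (H : forall k, exists l, Ctends (Csum (fun n => a (k + n)%nat * z ^ n)%C) l
                         /\ Cmod l <= B / (1 - Cmod z)).
  { intros k. apply (power_series_value (fun n => a (k + n)%nat)); auto. }
  destruct (functional_choice _ H) as [b Hb].
  destruct (disk_sum_exists (fun k => b (S k)) (B / (1 - Cmod z))) as [Q HQ].
  { intros n. apply Hb. }
  exists (fun k => b (S k)), Q. split; [intros n; apply Hb | split; [assumption |]].
  assert (Hrec : forall k, b k = (a k + z * b (S k))%C).
  { intros k. destruct (Hb k) as [H1 _]. destruct (Hb (S k)) as [H2 _].
    apply (Ctends_unique (fun N => Csum (fun n => a (k + n)%nat * z ^ n)%C (1 + N))).
    - exact (Ctends_shift _ _ H1).
    - replace (a k + z * b (S k))%C with (z * b (S k) + a k)%C by ring.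
      eapply Ctends_ext; [| exact (Ctends_plus _ _ _ _ (Ctends_scal z _ _ H2) (Ctends_const (a k)))].
      intros N. cbv beta. rewrite (Csum_add _ 1 N), <- Csum_scal. cbn [Csum].
      rewrite Nat.add_0_r.
      rewrite (Csum_ext (fun n => a (k + (1 + n))%nat * z ^ (1 + n))%C
                 (fun n => z * (a (S k + n)%nat * z ^ n))%C).
      + simpl. ring.
      + intros n _. replace (k + (1 + n))%nat with (S k + n)%nat by lia. simpl. ring. }
  assert (H0 : g z = b O).
  { exact (Ctends_unique _ _ _ (Hg z Hz) (proj1 (Hb O))). }
  intros w Hw.
  (* Telescoping by [b k = a k + z * b (S k)]; here [b (S k)] is the coefficient of index [k]
     of the quotient. *)
  assert (Hfin : forall N, ((w - z) * Csum (fun k => b (S k) * w ^ k) N)%C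
                  = (b N * w ^ N + (Csum (fun k => a k * w ^ k) N + - b O))%C).
  { induction N as [| N IH]; [simpl; ring |]. cbn [Csum].
    rewrite Cmult_plus_distr_l, IH, (Hrec N), Cpow_S. ring. }
  assert (L1 := Ctends_scal (w - z) _ _ (HQ w Hw)).
  symmetry. apply (Ctends_unique _ _ _ L1).
  eapply Ctends_ext; [intros N; symmetry; apply Hfin |].
  replace (g w - g z)%C with (0 + (g w + - b O))%C by (rewrite H0; ring).
  apply Ctends_plus; [| apply Ctends_plus].
  - intros e He. destruct (pow_small (Cmod w) (B / (1 - Cmod z)) e) as [N HN].
    + split; [apply Cmod_ge_0 | assumption].
    + eapply Rle_trans; [apply Cmod_ge_0 | apply (Hb O)].
    + assumption.
    + exists N. intros n Hn. unfold Cminus. rewrite Copp_0, Cplus_0_r, Cmod_mult, Cmod_pow.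
      eapply Rle_trans; [| apply (HN n Hn)]. apply Rmult_le_compat_r; [apply pow_le, Cmod_ge_0 |].
      apply Hb.
  - exact (Hg w Hw).
  - apply Ctends_const.
Qed.

Lemma disk_sum_lipschitz (a : nat -> C) (B : R) (g : C -> C) (z w : C) :
  (forall n, Cmod (a n) <= B) -> disk_sum a g -> Cmod z < 1 -> Cmod w < 1 ->
  Cmod (g w - g z) <= Cmod (w - z) * (B / (1 - Cmod z) / (1 - Cmod w)).
Proof.
  intros Ha Hg Hz Hw.
  destruct (disk_sum_quotient a B g z Ha Hg Hz) as (b & Q & Hb & HQ & E).
  rewrite (E w Hw), Cmod_mult. apply Rmult_le_compat_l; [apply Cmod_ge_0 |].
  apply (disk_sum_bound b _ Q w Hb HQ Hw).
Qed.

Lemma locally_C_of_Cmod (z : C) (P : C -> Prop) (d : R) : 0 < d ->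
  (forall w, Cmod (w - z) < d -> P w) -> locally z P.
Proof.
  intros Hd H. assert (Hd2 : 0 < d / 2) by lra.
  exists (mkposreal _ Hd2). intros w [H1 H2]. apply H.
  change (Rabs (fst w - fst z) < d / 2) in H1. change (Rabs (snd w - snd z) < d / 2) in H2.
  replace (w - z)%C with (RtoC (fst w - fst z) + RtoC (snd w - snd z) * Ci)%C.
  - eapply Rle_lt_trans; [apply Cmod_triangle |].
    rewrite Cmod_mult, !Cmod_R, Cmod_Ci. lra.
  - apply injective_projections; simpl; ring.
Qed.

Lemma ball_C_of_Cmod (z w : C) (e : R) : Cmod (w - z) < e -> @ball C_UniformSpace z e w.
Proof.
  intros H. pose proof (Rmax_Cmod (w - z)%C) as M. split.
  - change (Rabs (fst w - fst z) < e).
    eapply Rle_lt_trans; [| exact H]. eapply Rle_trans; [| exact M]. apply Rmax_l.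
  - change (Rabs (snd w - snd z) < e).
    eapply Rle_lt_trans; [| exact H]. eapply Rle_trans; [| exact M]. apply Rmax_r.
Qed.

Lemma disk_sum_is_pseries (a : nat -> C) (g : C -> C) (z : C) :
  disk_sum a g -> Cmod z < 1 -> @is_pseries C_AbsRing C_NormedModule a z (g z).
Proof.
  intros Hg Hz. unfold is_pseries, is_series.
  assert (E : forall n, sum_n (fun k => scal (pow_n (K := C_AbsRing) z k) (a k : C_NormedModule)) n
                = Csum (fun k => a k * z ^ k)%C (S n)).
  { assert (P : forall k, pow_n (K := C_AbsRing) z k = (z ^ k)%C).
    { induction k as [| k IH]; [reflexivity |]. simpl. rewrite IH. reflexivity. }
    induction n as [| n IH].
    - rewrite sum_O. simpl. change ((1 * a O)%C = (0 + a O * 1)%C). ring.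
    - rewrite sum_Sn, IH, P. change (Csum (fun k => a k * z ^ k) (S n) + z ^ S n * a (S n)
        = Csum (fun k => a k * z ^ k) (S n) + a (S n) * z ^ S n)%C. ring. }
  apply (filterlim_ext _ _ (fun n => eq_sym (E n))).
  apply filterlim_locally. intros e. pose proof (cond_pos e).
  destruct (Hg z Hz (e / 2)) as [N HN]; [lra |].
  exists N. intros n Hn. apply ball_C_of_Cmod. specialize (HN (S n) ltac:(lia)). lra.
Qed.

Lemma disk_sum_analytic (a : nat -> C) (B : R) (g : C -> C) :
  (forall n, Cmod (a n) <= B) -> disk_sum a g -> analytic_on_disk g.
Proof.
  intros Ha Hg z Hz. unfold unit_disk in Hz.
  destruct (disk_sum_quotient a B g z Ha Hg Hz) as (b & Q & Hb & HQ & E).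
  exists (Q z). split; [apply is_linear_scal_l |].
  intros x Hx e. apply (is_filter_lim_locally_unique (V := AbsRing_NormedModule C_AbsRing)) in Hx. subst x.
  set (K := B / (1 - Cmod z)).
  assert (HK : 0 <= K).
  { eapply Rle_trans; [apply Cmod_ge_0 | apply (Hb O)]. }
  set (rho := (1 - Cmod z) / 2). assert (Hrho : 0 < rho) by (unfold rho; lra).
  set (L := K / (1 - Cmod z) / rho).
  assert (HL : 0 <= L).
  { apply Rmult_le_pos; [apply Rmult_le_pos |]; try assumption;
      apply Rlt_le, Rinv_0_lt_compat; lra. }
  pose proof (cond_pos e) as He.
  assert (Hd : 0 < Rmin rho (e / (L + 1))).
  { apply Rmin_glb_lt; [assumption | apply Rdiv_lt_0_compat; lra]. }
  exists (mkposreal _ Hd). intros w Hw. change (Cmod (w - z) < Rmin rho (e / (L + 1))) in Hw.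
  pose proof (Rmin_l rho (e / (L + 1))). pose proof (Rmin_r rho (e / (L + 1))).
  change (Cmod (g w - g z - (w - z) * Q z) <= e * Cmod (w - z)).
  pose proof (Cmod_le_of_close w z) as Hwz.
  assert (Hw1 : Cmod w <= 1 - rho) by (unfold rho in *; lra).
  rewrite E by lra.
  replace ((w - z) * Q w - (w - z) * Q z)%C with ((w - z) * (Q w - Q z))%C by ring.
  rewrite Cmod_mult, Rmult_comm. apply Rmult_le_compat_r; [apply Cmod_ge_0 |].
  eapply Rle_trans; [apply (disk_sum_lipschitz b K Q z w Hb HQ Hz); lra |].
  apply Rle_trans with (e / (L + 1) * L).
  - apply Rmult_le_compat; try apply Cmod_ge_0; try lra.
    + apply Rmult_le_pos; [apply Rmult_le_pos |]; try assumption;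
        apply Rlt_le, Rinv_0_lt_compat; lra.
    + unfold L. apply Rmult_le_compat_l.
      * apply Rmult_le_pos; [assumption | apply Rlt_le, Rinv_0_lt_compat; lra].
      * apply Rinv_le_contravar; lra.
  - apply Rmult_le_reg_r with (L + 1); [lra |].
    replace (e / (L + 1) * L * (L + 1)) with (e * L) by (field; lra). nra.
Qed.

(** * A nonzero mean makes the integrals over arcs diverge *)

Lemma arith_geometric_partial_sum_le (r : R) (N : nat) : 0 <= r < 1 ->
  Rsum (fun n => (INR n + 1) * r ^ n) N <= / (1 - r) ^ 2.
Proof.
  intros Hr.
  assert (A : (1 - r) ^ 2 * Rsum (fun n => (INR n + 1) * r ^ n) N
              = 1 - (INR N + 1) * r ^ N + INR N * r ^ S N).
  { induction N as [| N IH]; [simpl; ring |].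
    rewrite S_INR. simpl Rsum. rewrite Rmult_plus_distr_l, IH. simpl. ring. }
  apply Rmult_le_reg_l with ((1 - r) ^ 2); [apply pow_lt; lra |].
  rewrite A, Rinv_r by (apply pow_nonzero; lra).
  pose proof (pow_le r N (proj1 Hr)) as Hp. pose proof (pos_INR N).
  assert (INR N * (r * r ^ N) <= INR N * r ^ N) by (apply Rmult_le_compat_l; nra).
  simpl. lra.
Qed.

(** For [n < N] one has [r^N <= r^n], so the left side is at most a geometric sum. *)
Lemma INR_mult_pow_le (r : R) (N : nat) : 0 <= r < 1 -> INR N * r ^ N <= / (1 - r).
Proof.
  intros Hr. rewrite <- (Rsum_const (r ^ N)).
  apply Rle_trans with (Rsum (fun n => r ^ (0 + n)) N).
  - apply Rsum_le. intros n Hn. simpl.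
    replace N with (n + (N - n))%nat by lia. rewrite pow_add.
    pose proof (pow_le r n (proj1 Hr)).
    assert (r ^ (N - n) <= 1).
    { rewrite <- (pow1 (N - n)). apply pow_incr; lra. }
    nra.
  - eapply Rle_trans; [apply geometric_partial_sum_le, Hr |]. simpl. right. field. lra.
Qed.

(** Abel summation against the partial sums of [a n - c], which are at most [eps n + K].
    In a Stolz angle [|1 - w|] is comparable to [1 - |w|], so the right side is of order [eps]
    as [w] tends to [1]. *)
Lemma mean_gives_pole (a : nat -> C) (c : C) (B : R) (g : C -> C) :
  (forall n, Cmod (a n) <= B) -> disk_sum a g -> has_mean a c ->
  forall eps, 0 < eps -> exists K, 0 <= K /\ forall w, Cmod w < 1 ->
    Cmod ((1 - w) * g w - c)
    <= 2 * Cmod (1 - w) ^ 2 * (eps / (1 - Cmod w) ^ 2 + K / (1 - Cmod w)).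
Proof.
  intros Ha Hg Hc e He. destruct (Hc e He) as [N0 HN0].
  assert (HB : 0 <= B) by (pose proof (Ha O); pose proof (Cmod_ge_0 (a O)); lra).
  pose proof (Cmod_ge_0 c) as Hc0.
  set (K := INR N0 * (B + Cmod c)).
  assert (HK : 0 <= K) by (apply Rmult_le_pos; [apply pos_INR | lra]).
  set (sg := fun N => (Csum a N - INR N * c)%C).
  assert (Hsg : forall N, Cmod (sg N) <= e * INR N + K).
  { intros N. destruct (Nat.le_gt_cases N0 N) as [L | L].
    - specialize (HN0 N L). unfold sg. lra.
    - unfold sg, Cminus. eapply Rle_trans; [apply Cmod_triangle |].
      rewrite Cmod_opp, Cmod_mult, Cmod_R, Rabs_pos_eq by apply pos_INR.
      assert (S1 : Cmod (Csum a N) <= Rsum (fun _ => B) N) by (apply Csum_Cmod_le; auto).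
      rewrite Rsum_const in S1. pose proof (pos_INR N).
      assert (INR N <= INR N0) by (apply le_INR; lia). unfold K. nra. }
  exists K. split; [assumption |]. intros w Hw.
  set (r := Cmod w) in *. assert (Hr : 0 <= r < 1) by (split; [apply Cmod_ge_0 | assumption]).
  set (m := Cmod (1 - w)).
  assert (Hm : 1 - r <= m).
  { unfold m, r. pose proof (Cmod_le_of_close 1 w) as T. rewrite Cmod_1 in T. lra. }
  (* Finite Abel summation; although the last term tends to [0], a bound is enough for it. *)
  assert (Habel : forall N, ((1 - w) * Csum (fun n => a n * w ^ n) N - c * (1 - w ^ N))%C
     = ((1 - w) * (1 - w) * Csum (fun n => sg (S n) * w ^ n) N + (1 - w) * (sg N * w ^ N))%C).
  { induction N as [| N IH].
    - unfold sg. simpl. ring.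
    - cbn [Csum].
      replace ((1 - w) * (Csum (fun n => a n * w ^ n) N + a N * w ^ N) - c * (1 - w ^ S N))%C
        with (((1 - w) * Csum (fun n => a n * w ^ n) N - c * (1 - w ^ N))
              + (1 - w) * ((a N - c) * w ^ N))%C by (rewrite Cpow_S; ring).
      rewrite IH. unfold sg. cbn [Csum]. rewrite S_INR, RtoC_plus, Cpow_S. ring. }
  apply (Ctends_bound (fun N => (1 - w) * Csum (fun n => a n * w ^ n) N - c * (1 - w ^ N))%C _ _ 0%nat).
  - replace ((1 - w) * g w - c)%C with ((1 - w) * g w + (- c + c * 0))%C by ring.
    apply Ctends_ext with (u := fun N => ((1 - w) * Csum (fun n => a n * w ^ n) N + (- c + c * w ^ N))%C).
    { intros N. ring. }
    apply Ctends_plus; [apply Ctends_scal, Hg, Hw |].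
    apply Ctends_plus; [apply Ctends_const |]. apply Ctends_scal.
    intros d Hd. destruct (pow_small r 1 d Hr) as [N HN]; [lra | assumption |].
    exists N. intros n Hn. specialize (HN n Hn).
    unfold Cminus. rewrite Copp_0, Cplus_0_r, Cmod_pow. fold r. lra.
  - intros N _. rewrite Habel.
    eapply Rle_trans; [apply Cmod_triangle |]. rewrite !Cmod_mult. fold m.
    assert (S1 : Cmod (Csum (fun n => sg (S n) * w ^ n)%C N) <= e / (1 - r) ^ 2 + K / (1 - r)).
    { eapply Rle_trans.
      - apply Csum_Cmod_le with (v := fun n => e * ((INR n + 1) * r ^ n) + K * r ^ (0 + n)).
        intros n _. rewrite Cmod_mult, Cmod_pow. fold r. specialize (Hsg (S n)).
        rewrite S_INR in Hsg. pose proof (pow_le r n (proj1 Hr)). simpl. nra.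
      - rewrite Rsum_plus, !Rsum_scal.
        pose proof (arith_geometric_partial_sum_le r N Hr). pose proof (geometric_partial_sum_le r 0 N Hr) as G.
        apply Rplus_le_compat.
        + apply Rmult_le_compat_l; lra.
        + unfold Rdiv. apply Rmult_le_compat_l; [assumption |]. simpl in G. simpl. lra. }
    assert (S2 : Cmod (sg N) * Cmod (w ^ N) <= e / (1 - r) + K).
    { rewrite Cmod_pow. fold r. specialize (Hsg N). pose proof (INR_mult_pow_le r N Hr).
      pose proof (pow_le r N (proj1 Hr)).
      assert (r ^ N <= 1) by (rewrite <- (pow1 N); apply pow_incr; lra).
      unfold Rdiv. nra. }
    (* The boundary term costs no more than the main term because [1 - r <= |1 - w|]. *)
    assert (S3 : e / (1 - r) + K <= m * (e / (1 - r) ^ 2 + K / (1 - r))).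
    { replace (e / (1 - r) + K) with ((1 - r) * (e / (1 - r) ^ 2 + K / (1 - r))) by (field; lra).
      apply Rmult_le_compat_r; [| assumption].
      apply Rplus_le_le_0_compat; apply Rmult_le_pos; try lra;
        apply Rlt_le, Rinv_0_lt_compat; try apply pow_lt; lra. }
    assert (m * m * Cmod (Csum (fun n => sg (S n) * w ^ n)%C N)
            <= m * m * (e / (1 - r) ^ 2 + K / (1 - r))) by (apply Rmult_le_compat_l; nra).
    assert (m * (Cmod (sg N) * Cmod (w ^ N)) <= m * (m * (e / (1 - r) ^ 2 + K / (1 - r))))
      by (apply Rmult_le_compat_l; lra).
    replace (2 * m ^ 2 * (e / (1 - r) ^ 2 + K / (1 - r)))
      with (m * m * (e / (1 - r) ^ 2 + K / (1 - r)) + m * (m * (e / (1 - r) ^ 2 + K / (1 - r))))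
      by ring.
    lra.
Qed.

(** Rotating the variable moves the frequency of interest to the point [w = 1]. *)
Lemma disk_sum_rotate (a : nat -> C) (g : C -> C) (b : R) :
  disk_sum a g -> disk_sum (fun n => a n * expi (INR n * b))%C (fun w => g (expi b * w)%C).
Proof.
  intros Hg w Hw.
  assert (H1 : Cmod (expi b * w) < 1) by (rewrite Cmod_mult, Cmod_expi; lra).
  eapply Ctends_ext; [| exact (Hg _ H1)]. intros N. apply Csum_ext. intros n _.
  rewrite Cpow_mult_l. replace (expi b ^ n)%C with (expi (INR n * b)); [ring |].
  induction n as [| n IH].
  - simpl. rewrite Rmult_0_l. apply expi_0.
  - rewrite S_INR, Rmult_plus_distr_r, Rmult_1_l, expi_add, IH, Cpow_S. ring.
Qed.

Lemma circle_modulus_continuous (a : nat -> C) (B : R) (g : C -> C) (r t : R) :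
  (forall n, Cmod (a n) <= B) -> disk_sum a g -> 0 < r < 1 ->
  continuous (fun s => Cmod (g (RtoC r * expi s)%C)) t.
Proof.
  intros Ha Hg Hr.
  assert (HB : 0 <= B) by (pose proof (Ha O); pose proof (Cmod_ge_0 (a O)); lra).
  assert (Hmod : forall s, Cmod (r * expi s) = r).
  { intros s. rewrite Cmod_mult, Cmod_expi, Cmod_R, Rabs_pos_eq; lra. }
  set (L := B / (1 - r) / (1 - r)).
  assert (HL : 0 <= L).
  { repeat apply Rmult_le_pos; try assumption; apply Rlt_le, Rinv_0_lt_compat; lra. }
  apply filterlim_locally. intros e. pose proof (cond_pos e) as He.
  assert (Hd : 0 < e / (L + 1)) by (apply Rdiv_lt_0_compat; lra).
  exists (mkposreal _ Hd). intros s Hs. change (Rabs (s - t) < e / (L + 1)) in Hs.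
  change (Rabs (Cmod (g (r * expi s)%C) - Cmod (g (r * expi t)%C)) < e).
  assert (D : Cmod (g (r * expi s)%C - g (r * expi t)%C) <= Rabs (s - t) * L).
  { eapply Rle_trans; [apply (disk_sum_lipschitz a B g); auto; rewrite Hmod; lra |].
    rewrite !Hmod. fold L. apply Rmult_le_compat_r; [assumption |].
    replace (r * expi s - r * expi t)%C with (r * (expi s - expi t))%C by ring.
    rewrite Cmod_mult, Cmod_R, Rabs_pos_eq by lra.
    pose proof (Cmod_expi_minus_le s t). pose proof (Cmod_ge_0 (expi s - expi t)%C). nra. }
  assert (D2 : Rabs (s - t) * L < e).
  { apply Rle_lt_trans with (e / (L + 1) * L).
    - apply Rmult_le_compat_r; lra.
    - apply Rmult_lt_reg_r with (L + 1); [lra |].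
      replace (e / (L + 1) * L * (L + 1)) with (e * L) by (field; lra). nra. }
  pose proof (Cmod_le_of_close (g (r * expi s)%C) (g (r * expi t)%C)) as T1.
  pose proof (Cmod_le_of_close (g (r * expi t)%C) (g (r * expi s)%C)) as T2.
  rewrite Cmod_minus_sym in T2. apply Rabs_def1; lra.
Qed.

(** On the piece of the circle of radius [r = 1 - d] with angles between [be] and
    [be + X d], the modulus of [g] is at least [|c| / (d + t - be)] up to an error whose
    integral is at most [3 / 2].  The main term integrates to [|c| ln (1 + X)]. *)
Lemma pole_integral_diverges (a : nat -> C) (c : C) (B : R) (g : C -> C) (al be b M : R) :
  (forall n, Cmod (a n) <= B) -> disk_sum a g ->
  has_mean (fun n => a n * expi (INR n * be))%C c -> c <> 0 -> al < be < b -> 0 <= M ->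
  exists r, 0 < r < 1 /\ M < RInt (fun t => Cmod (g (RtoC r * expi t)%C)) al b.
Proof.
  intros Ha Hg Hc Hc0 Hbe HM.
  assert (Hcp : 0 < Cmod c) by (apply Cmod_gt_0; assumption).
  (* [X] makes [|c| ln (1 + X) >= M + 2]; then [e] makes the [e]-part of the error equal to
     [1]; then [d] makes its [K]-part at most [1 / 2] and keeps the piece inside the arc. *)
  set (X := exp ((M + 2) / Cmod c)). assert (HX : 0 < X) by apply exp_pos.
  set (e := / (2 * X * (1 + X))).
  assert (He : 0 < e) by (apply Rinv_0_lt_compat; nra).
  assert (Ha' : forall n, Cmod (a n * expi (INR n * be)) <= B).
  { intros n. rewrite Cmod_mult, Cmod_expi, Rmult_1_r. apply Ha. }
  destruct (mean_gives_pole _ c B _ Ha' (disk_sum_rotate a g be Hg) Hc e He)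
    as (K & HK & Hpole).
  set (Q := 2 * X * (1 + X)). assert (HQ : 0 < Q) by (unfold Q; nra).
  set (d := Rmin (1 / 2) (Rmin ((b - be) / X) (/ (2 * Q * (K + 1))))).
  assert (Hd : 0 < d).
  { unfold d. repeat apply Rmin_glb_lt; [lra | apply Rdiv_lt_0_compat; lra |].
    apply Rinv_0_lt_compat. nra. }
  assert (Hd1 : d <= 1 / 2) by apply Rmin_l.
  assert (Hd2 : X * d <= b - be).
  { apply Rle_trans with (X * ((b - be) / X)); [| right; field; lra].
    apply Rmult_le_compat_l; [lra |]. unfold d.
    eapply Rle_trans; [apply Rmin_r | apply Rmin_l]. }
  assert (Hd3 : Q * (K * d) <= 1 / 2).
  { assert (Hd4 : d <= / (2 * Q * (K + 1))).
    { unfold d. eapply Rle_trans; [apply Rmin_r | apply Rmin_r]. }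
    apply Rle_trans with (Q * ((K + 1) * / (2 * Q * (K + 1)))); [| right; field; lra].
    apply Rmult_le_compat_l; [lra |]. apply Rmult_le_compat; lra. }
  set (r := 1 - d). assert (Hr : 0 < r < 1) by (unfold r; lra).
  exists r. split; [assumption |].
  set (phi := fun t => Cmod (g (r * expi t)%C)).
  assert (Hcont : forall x y, ex_RInt phi x y).
  { intros x y. apply (@ex_RInt_continuous R_CompleteNormedModule). intros z _.
    apply (circle_modulus_continuous a B g r z Ha Hg Hr). }
  assert (Hpos : forall t, 0 <= phi t) by (intros; apply Cmod_ge_0).
  set (m := fun t => Cmod c / (d + (t - be)) - 2 * (1 + X) * (e / d + K)).
  set (be' := be + X * d).
  assert (Hlow : forall t, be < t < be' -> m t <= phi t).
  { intros t Ht. unfold be' in Ht. set (w := (r * expi (t - be))%C).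
    assert (Hw : Cmod w = r).
    { unfold w. rewrite Cmod_mult, Cmod_expi, Cmod_R, Rabs_pos_eq; lra. }
    specialize (Hpole w ltac:(lra)). rewrite Hw in Hpole. replace (1 - r) with d in Hpole by (unfold r; ring).
    cbv beta in Hpole.
    replace (expi be * w)%C with (r * expi t)%C in Hpole.
    2: { unfold w. replace t with (be + (t - be)) at 1 by ring. rewrite expi_add. ring. }
    set (p := Cmod (1 - w)) in *.
    assert (Hp1 : p <= d + (t - be)).
    { unfold p, w. replace (1 - r * expi (t - be))%C with (d + - (r * (expi (t - be) - 1)))%C
        by (unfold r; rewrite RtoC_minus; ring).
      eapply Rle_trans; [apply Cmod_triangle |].
      rewrite Cmod_opp, Cmod_mult, !Cmod_R, !Rabs_pos_eq by lra.
      rewrite <- expi_0.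
      pose proof (Cmod_expi_minus_le (t - be) 0) as E. rewrite Rminus_0_r, Rabs_pos_eq in E by lra.
      pose proof (Cmod_ge_0 (expi (t - be) - expi 0)%C). nra. }
    assert (Hp0 : d <= p).
    { unfold p. pose proof (Cmod_le_of_close 1 w) as T. rewrite Cmod_1, Hw in T. unfold r in T. lra. }
    pose proof (Cmod_le_of_close c ((1 - w) * g (r * expi t)%C)%C) as T.
    rewrite Cmod_minus_sym, Cmod_mult in T. fold p in T. fold (phi t) in T.
    assert (T2 : Cmod c / p <= phi t + 2 * p * (e / d ^ 2 + K / d)).
    { apply Rmult_le_reg_l with p; [lra |].
      replace (p * (Cmod c / p)) with (Cmod c) by (field; lra). nra. }
    assert (T3 : Cmod c / (d + (t - be)) <= Cmod c / p).
    { apply Rmult_le_compat_l; [lra |]. apply Rinv_le_contravar; lra. }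
    assert (T4 : 2 * p * (e / d ^ 2 + K / d) <= 2 * ((1 + X) * d) * (e / d ^ 2 + K / d)).
    { apply Rmult_le_compat_r; [| nra].
      apply Rplus_le_le_0_compat; apply Rmult_le_pos; try lra;
        apply Rlt_le, Rinv_0_lt_compat; try apply pow_lt; lra. }
    replace (2 * ((1 + X) * d) * (e / d ^ 2 + K / d)) with (2 * (1 + X) * (e / d + K)) in T4
      by (field; lra).
    unfold m. lra. }
  assert (Hint : is_RInt m be be'
     ((Cmod c * ln (d + (be' - be)) - 2 * (1 + X) * (e / d + K) * be')
      - (Cmod c * ln (d + (be - be)) - 2 * (1 + X) * (e / d + K) * be))).
  { apply (is_RInt_derive (fun t => Cmod c * ln (d + (t - be)) - 2 * (1 + X) * (e / d + K) * t) m).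
    - intros t Ht. assert (be <= be') by (unfold be'; nra).
      rewrite Rmin_left in Ht by lra. unfold m. set (k := 2 * (1 + X) * (e / d + K)).
      auto_derive; [lra | field; lra].
    - intros t Ht. assert (be <= be') by (unfold be'; nra).
      rewrite Rmin_left in Ht by lra. unfold m. set (k := 2 * (1 + X) * (e / d + K)).
      apply (ex_derive_continuous (fun t => Cmod c / (d + (t - be)) - k)).
      auto_derive. lra. }
  assert (Hval : M + 1 / 2 <= RInt m be be').
  { rewrite (is_RInt_unique _ _ _ _ Hint). unfold be'.
    replace (d + (be + X * d - be)) with (d * (1 + X)) by ring.
    replace (d + (be - be)) with d by ring. rewrite ln_mult by lra.
    assert (Hln : M + 2 <= Cmod c * ln (1 + X)).
    { apply Rle_trans with (Cmod c * ln X).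
      - unfold X. rewrite ln_exp. right. field. lra.
      - apply Rmult_le_compat_l; [lra |]. apply Rlt_le, ln_increasing; lra. }
    assert (HQe : Q * e = 1) by (unfold Q, e; field; lra).
    assert (E2 : 2 * (1 + X) * (e / d + K) * (be + X * d) - 2 * (1 + X) * (e / d + K) * be
                 = Q * e + Q * (K * d)) by (unfold Q; field; lra).
    lra. }
  assert (be <= be') by (unfold be'; nra).
  assert (Hmono : RInt m be be' <= RInt phi be be').
  { apply RInt_le; auto. eexists. exact Hint. }
  assert (Hsplit : RInt phi al b = RInt phi al be + (RInt phi be be' + RInt phi be' b)).
  { rewrite <- (RInt_Chasles phi al be b), <- (RInt_Chasles phi be be' b) by auto. reflexivity. }
  pose proof (RInt_ge_0 phi al be ltac:(lra) (Hcont _ _) (fun t _ => Hpos t)).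
  pose proof (RInt_ge_0 phi be' b ltac:(unfold be'; lra) (Hcont _ _) (fun t _ => Hpos t)).
  fold phi. lra.
Qed.

(** * The strong natural boundary *)

Lemma locally_Cmod_le (z : C) (e : R) : 0 < e -> locally z (fun w => Cmod (w - z) <= e).
Proof. intros He. apply locally_C_of_Cmod with e; [assumption | intros; lra]. Qed.

Lemma cont_at_of_circle_continuous (f : C -> C) (x : R) :
  circle_continuous_at f (expi x) -> cont_at (fun y => f (expi y)) x.
Proof.
  intros H e He. destruct (H _ (locally_Cmod_le (f (expi x)) e He)) as [d Hd].
  exists d. split; [apply cond_pos |]. intros y Hy. apply Hd.
  - apply ball_C_of_Cmod. eapply Rle_lt_trans; [apply Cmod_expi_minus_le | assumption].
  - apply Cmod_expi.
Qed.

Lemma arc_mean_RInt (a : nat -> C) (B : R) (g : C -> C) (al b r : R) :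
  (forall n, Cmod (a n) <= B) -> disk_sum a g -> 0 < r < 1 ->
  arc_mean g al b r = RInt (fun t => Cmod (g (RtoC r * expi t)%C)) al b / (2 * PI).
Proof.
  intros Ha Hg Hr. unfold arc_mean.
  set (phi := fun t => Cmod (g (RtoC r * expi t)%C)).
  assert (Hphi : ex_RInt phi al b).
  { apply (@ex_RInt_continuous R_CompleteNormedModule). intros z _.
    apply (circle_modulus_continuous a B g r z Ha Hg Hr). }
  pose proof (@RInt_scal R_CompleteNormedModule phi al b (/ (2 * PI)) Hphi) as E.
  change (RInt (fun t => / (2 * PI) * phi t) al b = / (2 * PI) * RInt phi al b) in E.
  unfold Rdiv. rewrite (Rmult_comm (RInt phi al b)), <- E.
  apply RInt_ext. intros t _. apply Rmult_comm.
Qed.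

Theorem theorem1p8 (f : C -> C)
  (hbounded : bounded_on_circle f)
  (hfinite : finitely_many_discontinuities f)
  (hjump : exists z : C,
      circle_discontinuity f z /\ unequal_one_sided_limits f z)
  (q : R) (hq : irrational q) (theta : R) :
  pseries_strong_natural_boundary
    (fun n : nat => f (expi (2 * PI * (q * INR n + theta)))).
Proof.
  destruct hbounded as [B HB]. destruct hfinite as [lst Hlst].
  destruct hjump as (z0 & _ & t & l1 & l2 & _ & Hl1 & Hl2 & Hne).
  set (F := fun x => f (expi x)).
  assert (HF : forall x, Cmod (F x) <= B) by (intros x; apply HB, Cmod_expi).
  set (a := fun n : nat => f (expi (2 * PI * (q * INR n + theta)))).
  assert (Ha : forall n, Cmod (a n) <= B) by (intros n; apply HF).
  assert (Horb : forall n, a n = F (2 * PI * theta + INR n * (2 * PI * q))).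
  { intros n. unfold a, F. do 2 f_equal. ring. }
  destruct (disk_sum_exists a B Ha) as [g Hg].
  exists g. split; [| split].
  - intros z Hz. apply disk_sum_is_pseries; assumption.
  - apply (disk_sum_analytic a B g Ha Hg).
  - intros al b Hab.
    destruct (jump_gives_resonance (2 * PI * theta) (2 * PI * q)
                (irrational_rotation_2PI q hq) F B lst t l1 l2 al b HF)
      as (j & k & c & Hk & Hc0 & Hc).
    + intros x k. unfold F. rewrite expi_period. reflexivity.
    + intros x Hx. apply cont_at_of_circle_continuous. apply NNPP. intros Hd.
      apply Hx, Hlst. split; [apply Cmod_expi | assumption].
    + intros e He. destruct (Hl1 _ (locally_Cmod_le l1 e He)) as [d Hd].
      exists d. split; [apply cond_pos |]. intros x Hx. apply Hd; [| lra].
      change (Rabs (x - t) < d). apply Rabs_def1; lra.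
    + intros e He. destruct (Hl2 _ (locally_Cmod_le l2 e He)) as [d Hd].
      exists d. split; [apply cond_pos |]. intros x Hx. apply Hd; [| lra].
      change (Rabs (x - t) < d). apply Rabs_def1; lra.
    + assumption.
    + lra.
    + set (be := 2 * PI * q * IZR j + 2 * PI * IZR k) in *.
      set (c' := (expi (- (IZR j * (2 * PI * theta))) * c)%C).
      assert (Hmean : has_mean (fun n => a n * expi (INR n * be))%C c').
      { eapply has_mean_ext; [| exact (has_mean_scal (expi (- (IZR j * (2 * PI * theta)))) _ _ Hc)].
        intros n. cbv beta. rewrite Horb.
        replace (INR n * be)
          with (- (IZR j * (2 * PI * theta)) + IZR j * (2 * PI * theta + INR n * (2 * PI * q))
                + 2 * PI * IZR (Z.of_nat n * k))
          by (rewrite mult_IZR, <- INR_IZR_INZ; unfold be; ring).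
        rewrite expi_period, (expi_add (- _)). ring. }
      assert (Hc' : c' <> 0) by (apply Cmult_neq_0; [apply expi_neq_0 | assumption]).
      pose proof PI_RGT_0 as HPI.
      assert (Hbig : forall M, 0 <= M -> exists r, 0 < r < 1 /\ M < arc_mean g al b r).
      { intros M HM.
        destruct (pole_integral_diverges a c' B g al be b (2 * PI * M) Ha Hg Hmean Hc' Hk)
          as (r & Hr & Hlt); [nra |].
        exists r. split; [assumption |]. rewrite (arc_mean_RInt a B) by assumption.
        apply Rmult_lt_reg_l with (2 * PI); [lra |].
        unfold Rdiv. rewrite (Rmult_comm (RInt _ _ _)), <- Rmult_assoc, Rinv_r, Rmult_1_l by lra.
        exact Hlt. }
      match goal with |- Lub_Rbar ?E = _ => destruct (Lub_Rbar_correct E) as [Hub _];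
        destruct (Lub_Rbar E) as [M | |]; [exfalso | reflexivity | exfalso] end.
      * destruct (Hbig (Rabs M) (Rabs_pos M)) as (r & Hr & Hlt).
        pose proof (Hub (arc_mean g al b r) (ex_intro _ r (conj Hr eq_refl))) as H.
        simpl in H. pose proof (Rle_abs M). lra.
      * destruct (Hbig 0 (Rle_refl 0)) as (r & Hr & Hlt).
        exact (Hub (arc_mean g al b r) (ex_intro _ r (conj Hr eq_refl))).
Qed.
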